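(* There is an absolute constant $C>0$ such that the following holds. Let $V$ be a finite set with $n=|V|\ge2$ and let $\mathcal{P}=(P_t)_{t\ge1}$ be a sequence of irreducible, lazy and reversible transition matrices on $V$ which all have the same stationary distribution $\pi$. Then, for the pull voting according to $\mathcal{P}$ (from any initial opinion configuration), $$t_{\mathrm{cons}}(\mathcal{P})=\mathbf{E}[\tau_{\mathrm{cons}}(\mathcal{P})]\le C\,t_{\mathrm{HIT}}(\mathcal{P}).$$
   Context: A transition matrix $P\in[0,1]^{V\times V}$ is a row-stochastic matrix. It is irreducible if for all $u,v$ there is $t>0$ with $P^t(u,v)>0$; lazy if $P(v,v)\ge 1/2$ for all $v$; reversible if $\pi(u)P(u,v)=\pi(v)P(v,u)$ for all $u,v$, where $\pi$ is its stationary distribution. $t_{\mathrm{hit}}(P)=\max_{u,w\in V}\mathbf{E}[\min\{t\ge 0:X_t=w\}\mid X_0=u]$ for the time-homogeneous chain $(X_t)$ with transition matrix $P$; $t_{\mathrm{HIT}}(\mathcal{P})=\max_{t\ge 1}t_{\mathrm{hit}}(P_t)$ (read as a supremum, assumed finite). Pull voting according to $\mathcal{P}$: each vertex $v\in V$ holds an opinion from a finite set $\Sigma\subseteq\{0,\dots,n-1\}$. At round $t\ge1$, simultaneously and independently, each vertex $u$ picks a vertex $v$ according to $P_t(u,\cdot)$ and replaces its opinion by the opinion that $v$ held at the beginning of the round. $\tau_{\mathrm{cons}}(\mathcal{P})$ is the first time (number of rounds) at which all vertices hold the same opinion. *)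

(* Defs.v *)
From HB Require Import structures.
From mathcomp Require Import all_boot all_order all_algebra.
From mathcomp Require Import all_classical all_reals all_analysis.

Set Implicit Arguments.
Unset Strict Implicit.
Unset Printing Implicit Defensive.

Import Order.TTheory GRing.Theory Num.Theory.

Local Open Scope classical_set_scope.
Local Open Scope ring_scope.

Section TransitionMatrices.
Context {R : realType} {V : finType}.
Implicit Types (P : V -> V -> R) (pi : V -> R).

Definition transition_matrix P : Prop :=
  (forall u v, 0 <= P u v <= 1) /\ (forall u, \sum_(v : V) P u v = 1).

Definition mx_of P : 'M[R]_#|V| :=
  \matrix_(i, j) P (enum_val i) (enum_val j).

(* [step t P u v] is the entry P^t(u,v) of the t-th matrix power. *)
Definition step (t : nat) P (u v : V) : R :=
  (mx_of P ^+ t) (enum_rank u) (enum_rank v).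

Definition irreducible P : Prop :=
  forall u v, exists t : nat, (0 < t)%N /\ 0 < step t P u v.

Definition lazy P : Prop := forall v, 2^-1 <= P v v.

Definition stationary P pi : Prop :=
  [/\ forall v, 0 <= pi v, \sum_(v : V) pi v = 1
    & forall v, \sum_(u : V) pi u * P u v = pi v].

Definition reversible P pi : Prop :=
  forall u v, pi u * P u v = pi v * P v u.

End TransitionMatrices.

(* min {t | A t}, with the convention min set0 = +oo. *)
Definition first_time {R : realType} (A : set nat) : \bar R :=
  ereal_inf [set t%:R%:E | t in A].

Section HittingTimes.
Context {R : realType} {V : finType}.
Implicit Types (P : V -> V -> R).

(* X is a time-homogeneous Markov chain on Omega with transition matrix P and
   X_0 = u.  The Markov property
   Pr(X_{t+1} = x_{t+1} | X_0 = x_0, ..., X_t = x_t) = P(x_t, x_{t+1})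
   is written in product form, so that null conditioning events are allowed. *)
Definition markov_chain d (Omega : measurableType d) (Pr : probability Omega R)
    P (u : V) (X : nat -> Omega -> V) : Prop :=
  [/\ forall t v, measurable (X t @^-1` [set v]),
      Pr (X 0%N @^-1` [set u]) = 1%E
    & forall (t : nat) (x : nat -> V),
        Pr [set w | forall s, (s <= t.+1)%N -> X s w = x s] =
        (Pr [set w | forall s, (s <= t)%N -> X s w = x s]
          * (P (x t) (x t.+1))%:E)%E].

(* E[min {t >= 0 : X_t = w} | X_0 = u].  The law of (X_t), hence this
   expectation, does not depend on the probability space carrying the chain:
   for a transition matrix P the supremum is over a set with exactly one
   element. *)
Definition expected_hit P (u w : V) : \bar R :=
  ereal_sup [set e | exists (d : measure_display) (Omega : measurableType d)
    (Pr : probability Omega R) (X : nat -> Omega -> V),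
    markov_chain Pr P u X /\
    e = (\int[Pr]_om first_time [set t | X t om = w])%E].

Definition t_hit P : \bar R :=
  \big[maxe/-oo%E]_(u : V) \big[maxe/-oo%E]_(w : V) expected_hit P u w.

(* The sequence (P_t)_{t >= 1} is a function on nat whose value at 0 is never
   used. *)
Definition t_HIT (P : nat -> V -> V -> R) : \bar R :=
  ereal_sup [set t_hit (P t) | t in [set t | (1 <= t)%N]].

End HittingTimes.

Section PullVoting.
Context {R : realType} {V : finType}.

(* Mutual independence, over all rounds t >= 1 and all vertices, of the
   V-valued random variables Y t u (product rule on finite subfamilies). *)
Definition mutually_independent d (Omega : measurableType d)
    (Pr : probability Omega R) (Y : nat -> V -> Omega -> V) : Prop :=
  forall (s : seq (nat * V)) (x : nat -> V -> V),
    uniq s -> (forall i, i \in s -> (1 <= i.1)%N) ->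
    Pr [set w | forall i, i \in s -> Y i.1 i.2 w = x i.1 i.2] =
    (\prod_(i <- s) Pr (Y i.1 i.2 @^-1` [set x i.1 i.2]))%E.

(* Y t u is the vertex picked by u at round t >= 1. *)
Definition pull_picks d (Omega : measurableType d) (Pr : probability Omega R)
    (P : nat -> V -> V -> R) (Y : nat -> V -> Omega -> V) : Prop :=
  [/\ forall t u v, (1 <= t)%N -> measurable (Y t u @^-1` [set v]),
      forall t u v, (1 <= t)%N -> Pr (Y t u @^-1` [set v]) = (P t u v)%:E
    & mutually_independent Pr Y].

Context {Sigma : Type} {Omega : Type}.

(* opinions Y xi0 t w u is the opinion of u after t rounds. *)
Fixpoint opinions (Y : nat -> V -> Omega -> V) (xi0 : V -> Sigma) (t : nat)
    (w : Omega) : V -> Sigma :=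
  if t is t'.+1 then fun u => opinions Y xi0 t' w (Y t u w) else xi0.

Definition consensus (xi : V -> Sigma) : Prop := forall u v, xi u = xi v.

Definition tau_cons (Y : nat -> V -> Omega -> V) (xi0 : V -> Sigma)
    (w : Omega) : \bar R :=
  first_time [set t | consensus (opinions Y xi0 t w)].

End PullVoting.

(* Main.v *)
From HB Require Import structures.
From mathcomp Require Import all_boot all_order all_algebra.
From mathcomp Require Import zify ring lra.
From mathcomp Require Import all_classical all_reals all_analysis.
From mathcomp Require Import measurable_realfun.
Require Import Defs.

Set Implicit Arguments.
Unset Strict Implicit.
Unset Printing Implicit Defensive.

Import Order.TTheory GRing.Theory Num.Theory.
Import numFieldNormedType.Exports.

Local Open Scope ring_scope.

(* The opinions after [t] rounds come from the endpoints of coalescing random walks that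
   use the matrices [P_t, ..., P_1], so it suffices to show that, for an arbitrary list of
   about [62 n] matrices with [n] close to [t_HIT], the walks started from all vertices have
   merged with probability at least [1/2]; independence of successive blocks of rounds then
   gives a geometric tail.

   Write [H] for a common bound on the hitting times.  (1) The expected hitting time of [x]
   is a supersolution of the chain killed at [x], and a laziness argument then shows that
   the operator "move, then kill at a prescribed vertex" contracts L2(pi) by [1 - 1/H] at
   each round, even along a moving target; the same function gives
   [sup |f - 1|^2 <= H E(f, f)] with [E] the Dirichlet form, whence the variance [V_t] of
   a density satisfies [V_t^2 <= H (V_t - V_(t+1))] and walks are mixed after [4 H] rounds.
   (2) Split the walks dyadically: in phase [r] only the walks with index in
   [(2^r, 2^(r+1)]] may be killed, by any of the first [2^r] walks, which ignore each other.
   Conditionally on the trajectory of one walk, the [2^r] independent walks avoid it with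
   probability at most
   [(1 - 1/H)^(2^r T_r/4)], so phases of length [T_r] of order [H (r + 1)/2^r] have summable
   failure probabilities and total length [O(H)].

   The supremum defining the expected hitting time is bounded from below by building a
   chain with a given transition matrix on the unit interval. *)

(** * Reversible chains in L2 *)

(** Evaluate the quadratic at its minimiser [- b / c]. If [c = 0] it is affine, and takes the value
    [-1] unless [b = 0]. *)
Lemma discriminant_le0 (R : realFieldType) (a b c : R) : 0 <= c ->
  (forall s, 0 <= a + 2 * s * b + s ^+ 2 * c) -> b ^+ 2 <= a * c.
Proof.
rewrite le_eqVlt => /predU1P[<- q_ge0|c_gt0 q_ge0].
  have [->|b0] := eqVneq b 0; first by rewrite expr0n /= mulr0.
  have := q_ge0 (- (a + 1) / (2 * b)).
  have -> : a + 2 * (- (a + 1) / (2 * b)) * b + (- (a + 1) / (2 * b)) ^+ 2 * 0 = - 1.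
    by field.
  by rewrite lerNr oppr0 ler10.
have := q_ge0 (- b / c).
have -> : a + 2 * (- b / c) * b + (- b / c) ^+ 2 * c = (a * c - b ^+ 2) / c.
  by field; rewrite gt_eqF.
by rewrite pmulr_lge0 ?invr_gt0// subr_ge0.
Qed.

Section QuadraticForms.
Context {R : realFieldType} {V : finType}.
Implicit Types (K : V -> V -> R) (f g : V -> R).

Definition form K f g : R := \sum_u \sum_v f u * K u v * g v.

(** The quadratic [s -> form K (f + s g) (f + s g)] is nonnegative. Semidefiniteness suffices, so
    this serves for the forms of [I], [P] and [I - P]. *)
Lemma form_cauchy_schwarz K f g :
  (forall u v, K u v = K v u) -> (forall h, 0 <= form K h h) ->
  form K f g ^+ 2 <= form K f f * form K g g.
Proof.
move=> Ksym Kge0; apply: discriminant_le0 => // s.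
have -> : form K f f + 2 * s * form K f g + s ^+ 2 * form K g g =
    form K (fun u => f u + s * g u) (fun u => f u + s * g u).
  have -> : 2 * s * form K f g = s * form K f g + s * form K g f.
    have -> : form K g f = form K f g; last by ring.
    rewrite /form exchange_big; apply: eq_bigr => u _; apply: eq_bigr => v _.
    by rewrite [in RHS]Ksym; ring.
  rewrite /form !mulr_sumr -!big_split /=; apply: eq_bigr => u _.
  rewrite !mulr_sumr -!big_split /=; apply: eq_bigr => v _; ring.
exact: Kge0.
Qed.

End QuadraticForms.

Lemma jensen_sqr (R : realFieldType) (T : finType) (k f : T -> R) :
  (forall v, 0 <= k v) -> \sum_v k v = 1 ->
  (\sum_v k v * f v) ^+ 2 <= \sum_v k v * f v ^+ 2.
Proof.
move=> k0 k1.
have E m : \sum_v k v * (f v - m) ^+ 2 =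
    \sum_v k v * f v ^+ 2 - 2 * m * (\sum_v k v * f v) + m ^+ 2 * \sum_v k v.
  by rewrite !mulr_sumr -sumrB -big_split /=; apply: eq_bigr => v _; ring.
have : 0 <= \sum_v k v * (f v - \sum_v k v * f v) ^+ 2.
  by apply: sumr_ge0 => v _; rewrite mulr_ge0// sqr_ge0.
by rewrite E k1; lra.
Qed.

Section ReversibleChain.
Context {R : realFieldType} {V : finType}.
Variable pi : V -> R.
Hypotheses (pi_ge0 : forall v, 0 <= pi v) (pi_sum1 : \sum_v pi v = 1).
Implicit Types (P : V -> V -> R) (f g : V -> R) (N : R).

Definition apply_mx P f (u : V) : R := \sum_v P u v * f v.

Definition dot f g : R := \sum_v pi v * f v * g v.

(* The function [g] is the expected hitting time of [x]. *)
Definition hit_within P N := forall x, exists g : V -> R,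
  [/\ g x = 0, forall u, 0 <= g u <= N & forall u, u != x -> g u = 1 + apply_mx P g u].

Definition good P N := [/\ [/\ forall u v, 0 <= P u v & forall u, \sum_v P u v = 1],
  forall v, 2^-1 <= P v v, forall u v, pi u * P u v = pi v * P v u & hit_within P N].

Lemma dotC f g : dot f g = dot g f.
Proof. by apply: eq_bigr => v _; ring. Qed.

Lemma dot_ge0 f : 0 <= dot f f.
Proof. by apply: sumr_ge0 => v _; rewrite -mulrA mulr_ge0// -expr2 sqr_ge0. Qed.

Lemma dot_form f g : dot f g = form (fun u v => pi u * (u == v)%:R) f g.
Proof.
apply: eq_bigr => u _; rewrite (bigD1 u)//= eqxx big1 ?addr0 ?mulr1; first by ring.
by move=> v /negPf vu; rewrite eq_sym vu !mulr0 mul0r.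
Qed.

Lemma dot_cauchy_schwarz f g : dot f g ^+ 2 <= dot f f * dot g g.
Proof.
rewrite !dot_form; apply: form_cauchy_schwarz => [u v|h].
  by have [->//|_] := eqVneq u v; rewrite !mulr0.
by rewrite -dot_form dot_ge0.
Qed.

Lemma dot_apply_form P f g : dot f (apply_mx P g) = form (fun u v => pi u * P u v) f g.
Proof. by apply: eq_bigr => u _; rewrite mulr_sumr; apply: eq_bigr => v _; ring. Qed.

Section Stochastic.
Variable P : V -> V -> R.
Hypotheses (P_ge0 : forall u v, 0 <= P u v) (P_sum1 : forall u, \sum_v P u v = 1).
Hypothesis P_rev : forall u v, pi u * P u v = pi v * P v u.

Lemma reversible_stationary f : \sum_u pi u * apply_mx P f u = \sum_u pi u * f u.
Proof.
under eq_bigr do rewrite mulr_sumr.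
rewrite exchange_big; apply: eq_bigr => v _ /=.
under eq_bigr do rewrite mulrA P_rev -mulrA mulrC -mulrA.
by rewrite -mulr_suml P_sum1 mul1r mulrC.
Qed.

Lemma apply_dotC f g : dot f (apply_mx P g) = dot (apply_mx P f) g.
Proof.
rewrite dot_apply_form [RHS]dotC dot_apply_form /form exchange_big.
by apply: eq_bigr => u _; apply: eq_bigr => v _; rewrite P_rev; ring.
Qed.

Lemma apply_contraction f : dot (apply_mx P f) (apply_mx P f) <= dot f f.
Proof.
have -> : dot f f = \sum_v pi v * f v ^+ 2 by apply: eq_bigr => v _; ring.
rewrite -reversible_stationary; apply: ler_sum => u _.
by rewrite -mulrA ler_wpM2l// -expr2 jensen_sqr.
Qed.

End Stochastic.

Section Good.
Variables (P : V -> V -> R) (N : R).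
Hypothesis gP : good P N.

Let P_ge0 u v : 0 <= P u v. Proof. by have [[]] := gP. Qed.
Let P_sum1 u : \sum_v P u v = 1. Proof. by have [[]] := gP. Qed.
Let P_lazy v : 2^-1 <= P v v. Proof. by have [] := gP. Qed.
Let P_rev u v : pi u * P u v = pi v * P v u. Proof. by have [] := gP. Qed.
Let P_hit : hit_within P N. Proof. by have [] := gP. Qed.

(* [2 P - I] is again stochastic and reversible, hence an L2-contraction. *)
Lemma lazy_apply_sqr f : dot (apply_mx P f) (apply_mx P f) <= dot f (apply_mx P f).
Proof.
pose Q u v := 2 * P u v - (u == v)%:R.
have Qge0 u v : 0 <= Q u v.
  rewrite /Q; have [<-|_] := eqVneq u v; last by rewrite subr0 mulr_ge0.
  by rewrite (_ : true%:R = 1)//; have := P_lazy u; lra.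
have Qsum u : \sum_v Q u v = 1.
  rewrite sumrB -mulr_sumr P_sum1 (bigD1 u)//= eqxx big1 ?addr0.
    by rewrite (_ : true%:R = 1)//; ring.
  by move=> v /negPf vu; rewrite eq_sym vu.
have Qrev u v : pi u * Q u v = pi v * Q v u.
  rewrite /Q !mulrBr !(mulrCA _ 2) P_rev.
  by have [->//|_] := eqVneq u v; rewrite !mulr0.
have QE u : apply_mx Q f u = 2 * apply_mx P f u - f u.
  rewrite /apply_mx /Q mulr_sumr; under eq_bigr do rewrite mulrBl.
  rewrite sumrB; congr (_ - _); first by apply: eq_bigr => v _; rewrite mulrA.
  rewrite (bigD1 u)//= eqxx big1 ?addr0 ?mul1r// => v /negPf vu.
  by rewrite eq_sym vu mul0r.
have := apply_contraction Qge0 Qsum Qrev f.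
have -> : dot (apply_mx Q f) (apply_mx Q f) =
    4 * dot (apply_mx P f) (apply_mx P f) - 4 * dot f (apply_mx P f) + dot f f.
  rewrite /dot !mulr_sumr -sumrB -big_split /=; apply: eq_bigr => v _.
  by rewrite QE; ring.
lra.
Qed.

Lemma lazy_psd f : 0 <= dot f (apply_mx P f).
Proof. exact: le_trans (dot_ge0 _) (lazy_apply_sqr f). Qed.

Definition dirichlet f := dot f f - dot f (apply_mx P f).

Lemma dirichlet_ge0 f : 0 <= dirichlet f.
Proof.
have : 0 <= dot (fun v => f v - apply_mx P f v) (fun v => f v - apply_mx P f v) by exact: dot_ge0.
have -> : dot (fun v => f v - apply_mx P f v) (fun v => f v - apply_mx P f v) =
   dot f f - 2 * dot f (apply_mx P f) + dot (apply_mx P f) (apply_mx P f).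
  by rewrite /dot mulr_sumr -sumrB -big_split /=; apply: eq_bigr => v _; ring.
by have := apply_contraction P_ge0 P_sum1 P_rev f; rewrite /dirichlet; lra.
Qed.

Lemma apply_psd_cauchy_schwarz f g :
  dot f (apply_mx P g) ^+ 2 <= dot f (apply_mx P f) * dot g (apply_mx P g).
Proof.
rewrite !dot_apply_form; apply: form_cauchy_schwarz => // h.
by rewrite -dot_apply_form lazy_psd.
Qed.

Lemma dirichlet_cauchy_schwarz f g :
  (dot f g - dot f (apply_mx P g)) ^+ 2 <= dirichlet f * dirichlet g.
Proof.
have E f1 g1 : dot f1 g1 - dot f1 (apply_mx P g1) =
    form (fun u v => pi u * (u == v)%:R - pi u * P u v) f1 g1.
  rewrite dot_form dot_apply_form -sumrB; apply: eq_bigr => u _.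
  by rewrite -sumrB; apply: eq_bigr => v _; ring.
rewrite /dirichlet !E; apply: form_cauchy_schwarz => [u v|h].
  rewrite P_rev; congr (_ - _).
  by have [->//|_] := eqVneq u v; rewrite !mulr0.
by rewrite -E dirichlet_ge0.
Qed.

(* Kac's formula for the mean return time to [x]. *)
Lemma kac x (g : V -> R) : g x = 0 -> (forall u, u != x -> g u = 1 + apply_mx P g u) ->
  pi x * (1 + apply_mx P g x) = 1.
Proof.
move=> gx0 gE; have := reversible_stationary P_sum1 P_rev g.
rewrite (bigD1 x)//= [RHS](bigD1 x)//= gx0 mulr0 add0r.
rewrite [RHS](eq_bigr (fun u => pi u + pi u * apply_mx P g u)); last first.
  by move=> u ux; rewrite {1}gE//; ring.
rewrite big_split /= => /addIr E.
by rewrite mulrDr mulr1 E -pi_sum1 [in RHS](bigD1 x).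
Qed.

Lemma apply_le f c u : (forall v, f v <= c) -> apply_mx P f u <= c.
Proof.
move=> fc; rewrite -[leRHS]mul1r -(P_sum1 u) mulr_suml.
by apply: ler_sum => v _; rewrite ler_wpM2l.
Qed.

Lemma apply_ge f c u : (forall v, c <= f v) -> c <= apply_mx P f u.
Proof.
move=> fc; rewrite -[leLHS]mul1r -(P_sum1 u) mulr_suml.
by apply: ler_sum => v _; rewrite ler_wpM2l.
Qed.

Lemma stationary_gt0 x : 0 < pi x.
Proof.
rewrite lt_neqAle pi_ge0 andbT; apply/eqP => px0.
have [g [gx0 _ gE]] := P_hit x; have := kac gx0 gE.
by rewrite -px0 mul0r => /eqP; rewrite eq_sym oner_eq0.
Qed.

(** Kac's formula gives [1 <= pi x * (1 + N)]; sum over [x]. *)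
Lemma card_le_hit : #|V|%:R <= 1 + N.
Proof.
have piN x : 1 <= pi x * (1 + N).
  have [g [gx0 gb gE]] := P_hit x.
  rewrite -{1}(kac gx0 gE) ler_wpM2l// lerD2l apply_le// => v.
  by have /andP[] := gb v.
have : \sum_(x : V) 1 <= \sum_x pi x * (1 + N) by apply: ler_sum.
by rewrite -mulr_suml pi_sum1 mul1r sumr_const.
Qed.

(* The hitting time of [x] is a positive supersolution of the chain killed at [x]. *)
Lemma killed_gap x f : 0 < N -> f x = 0 ->
  dot f (apply_mx P f) <= (1 - N^-1) * dot f f.
Proof.
move=> N0 fx0; have [g [gx0 gb gE]] := P_hit x.
have g1 u : u != x -> 1 <= g u.
  move=> ux; rewrite gE// lerDl; apply: apply_ge => v.
  by have /andP[] := gb v.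
have gpos u : u != x -> 0 < g u by move=> /g1; apply: lt_le_trans.
pose K u v := pi u * P u v.
have Kge0 u v : 0 <= K u v by rewrite mulr_ge0.
(* Weighted AM-GM, with weights taken from [g]. If [u] or [v] is [x], both sides vanish because
   [f x = g x = 0]. *)
have step1 u v : f u * K u v * f v *+ 2 <=
    K u v * (f u ^+ 2 / g u * g v) + K u v * (f v ^+ 2 / g v * g u).
  have [->|ux] := eqVneq u x.
    by rewrite fx0 gx0 !(mul0r, mulr0, expr0n, mul0rn)/= ?addr0 ?(mul0r, mulr0).
  have [->|vx] := eqVneq v x.
    by rewrite fx0 gx0 !(mul0r, mulr0, expr0n, mul0rn)/= ?addr0 ?(mul0r, mulr0).
  rewrite -subr_ge0.
  have -> : K u v * (f u ^+ 2 / g u * g v) + K u v * (f v ^+ 2 / g v * g u)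
      - f u * K u v * f v *+ 2 = K u v * ((f u * g v - f v * g u) ^+ 2 / (g u * g v)).
    by field; rewrite !gt_eqF ?gpos.
  by rewrite mulr_ge0// divr_ge0 ?sqr_ge0// mulr_ge0// ltW ?gpos.
have step2 : dot f (apply_mx P f) *+ 2 <=
    (\sum_u \sum_v K u v * (f u ^+ 2 / g u * g v)) *+ 2.
  rewrite [leRHS]mulr2n [X in _ <= _ + X]exchange_big -big_split /=.
  rewrite dot_apply_form -sumrMnl; apply: ler_sum => u _.
  rewrite -sumrMnl -big_split; apply: ler_sum => v _.
  by apply: le_trans (step1 u v) _; rewrite /= {2 4}/K P_rev.
rewrite ler_pMn2r// in step2; apply: le_trans step2 _.
rewrite mulr_sumr; apply: ler_sum => u _.
have [->|ux] := eqVneq u x.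
  rewrite fx0 mulr0 mulr0 big1// => v _; by rewrite gx0 expr0n /= !mul0r mulr0.
have -> : \sum_v K u v * (f u ^+ 2 / g u * g v) = pi u * f u ^+ 2 / g u * apply_mx P g u.
  by rewrite mulr_sumr; apply: eq_bigr => v _; rewrite /K; ring.
(* The supersolution property: off [x], [P g / g = 1 - 1 / g <= 1 - 1 / N]. *)
have -> : apply_mx P g u = g u - 1 by rewrite (gE u ux) addrC addKr.
have -> : pi u * f u ^+ 2 / g u * (g u - 1) = pi u * f u ^+ 2 * (1 - (g u)^-1).
  by field; rewrite gt_eqF ?gpos.
have -> : (1 - N^-1) * (pi u * f u * f u) = pi u * f u ^+ 2 * (1 - N^-1) by ring.
apply: ler_wpM2l; first exact: mulr_ge0 (pi_ge0 u) (sqr_ge0 _).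
rewrite lerD2l lerN2 lef_pV2 ?posrE ?gpos//.
by have /andP[] := gb u.
Qed.

Definition kill (h : V) f (v : V) : R := if v == h then 0 else f v.

Lemma killed_contraction h f :
  dot (kill h (apply_mx P f)) (kill h (apply_mx P f)) <= dot f f.
Proof.
apply: le_trans (apply_contraction P_ge0 P_sum1 P_rev f).
apply: ler_sum => v _; rewrite /kill; case: eqP => // _.
by rewrite mulr0 -mulrA mulr_ge0// -expr2 sqr_ge0.
Qed.

(** With [c] the killed function, [<c, c> = <c, P f>], so Cauchy-Schwarz for the form of [P] gives
    [<c, c>^2 <= <c, P c> <f, P f>]. As [c] vanishes at [h] and [f] at [x], [killed_gap] applies to
    both factors; [h] and [x] may differ, which is what permits a moving target. *)
Lemma killed_contraction_gap h x f : 1 <= N -> f x = 0 ->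
  dot (kill h (apply_mx P f)) (kill h (apply_mx P f)) <= (1 - N^-1) ^+ 2 * dot f f.
Proof.
move=> N1 fx0; have N0 : 0 < N by apply: lt_le_trans N1.
set c := kill h (apply_mx P f).
have cE : dot c c = dot c (apply_mx P f).
  by apply: eq_bigr => v _; rewrite /c /kill; case: eqP => // _; rewrite !mulr0 mul0r.
have := dot_ge0 c; rewrite le_eqVlt => /predU1P[<-|cpos].
  by rewrite mulr_ge0 ?sqr_ge0 ?dot_ge0.
rewrite -(ler_pM2l cpos).
have -> : dot c c * dot c c = dot c (apply_mx P f) ^+ 2 by rewrite expr2 -cE.
apply: le_trans (apply_psd_cauchy_schwarz c f) _.
have -> : dot c c * ((1 - N^-1) ^+ 2 * dot f f) =
   ((1 - N^-1) * dot c c) * ((1 - N^-1) * dot f f) by ring.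
apply: ler_pM; rewrite ?lazy_psd//; last exact: killed_gap N0 fx0.
have ch : c h = 0 by rewrite /c /kill eqxx.
exact: killed_gap N0 ch.
Qed.

(** Pairing [f] with the hitting time [g] of [x] gives [<f, (I - P) g> = pi(f) - f x], since
    [(I - P) g] is [1] off [x] and [1 - 1 / pi x] at [x] by Kac's formula. The Dirichlet form of [g]
    is its mean, hence at most [N]. *)
Lemma sup_dirichlet f x : (f x - \sum_v pi v * f v) ^+ 2 <= N * dirichlet f.
Proof.
have [g [gx0 gb gE]] := P_hit x.
have key h : dot h g - dot h (apply_mx P g) = \sum_v pi v * h v - h x.
  have Eg : apply_mx P g x = (1 - pi x) / pi x.
    have := kac gx0 gE; rewrite mulrDr mulr1 => <-.
    by field; rewrite gt_eqF ?stationary_gt0.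
  rewrite /dot -sumrB (bigD1 x)//= [in RHS](bigD1 x)//= gx0 Eg.
  rewrite (eq_bigr (fun v => pi v * h v)); last by move=> v vx; rewrite (gE v vx); ring.
  have px := stationary_gt0 x.
  have -> : pi x * h x * 0 - pi x * h x * ((1 - pi x) / pi x) = pi x * h x - h x.
    by field; rewrite gt_eqF.
  ring.
have -> : (f x - \sum_v pi v * f v) ^+ 2 = (dot f g - dot f (apply_mx P g)) ^+ 2.
  by rewrite key; ring.
apply: le_trans (dirichlet_cauchy_schwarz f g) _.
rewrite mulrC ler_wpM2r ?dirichlet_ge0// /dirichlet key gx0 subr0.
rewrite -[leRHS]mul1r -pi_sum1 mulr_suml; apply: ler_sum => v _.
by rewrite ler_wpM2l//; have /andP[] := gb v.
Qed.

(* The squared L2 distance of a density to equilibrium. *)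
Definition variance f := dot f f - 1.

Lemma apply_mean1 f : \sum_v pi v * f v = 1 -> \sum_v pi v * apply_mx P f v = 1.
Proof. by rewrite reversible_stationary. Qed.

Lemma apply_fun_ge0 f : (forall v, 0 <= f v) -> forall v, 0 <= apply_mx P f v.
Proof. by move=> f0 v; apply: sumr_ge0 => u _; rewrite mulr_ge0. Qed.

Lemma varianceE f : \sum_v pi v * f v = 1 ->
  variance f = dot (fun v => f v - 1) (fun v => f v - 1).
Proof.
move=> f1; rewrite /variance /dot.
have -> : \sum_v pi v * (f v - 1) * (f v - 1) =
    \sum_v pi v * f v * f v - 2 * (\sum_v pi v * f v) + \sum_v pi v.
  rewrite mulr_sumr -sumrB -big_split /=; apply: eq_bigr => v _; ring.
rewrite f1 pi_sum1; lra.
Qed.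

(* [variance f] is the mean of [f - 1] for the probability [pi f], so Jensen and
   the pointwise bound on [f - 1] apply. *)
Lemma variance_decay f : (forall v, 0 <= f v) -> \sum_v pi v * f v = 1 ->
  variance f ^+ 2 <= N * (variance f - variance (apply_mx P f)).
Proof.
move=> f0 f1.
have VE : variance f = \sum_v (pi v * f v) * (f v - 1).
  by rewrite /variance -{1}f1 /dot -sumrB; apply: eq_bigr => v _; ring.
apply: le_trans (_ : N * dirichlet f <= _).
  rewrite VE; apply: le_trans (jensen_sqr (fun v => f v - 1) _ f1) _.
    by move=> v; rewrite mulr_ge0.
  rewrite -[leRHS]mul1r -{2}f1 mulr_suml; apply: ler_sum => v _.
  rewrite ler_wpM2l ?mulr_ge0//.
  by have := sup_dirichlet f v; rewrite f1.
have N_ge0 : 0 <= N.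
  have [x _] : exists x : V, True.
    case: (pickP V) => [x _|V0]; first by exists x.
    by move: f1; rewrite big_pred0// => /eqP; rewrite eq_sym oner_eq0.
  by have [g [_ /(_ x) /andP[g0 gN] _]] := P_hit x; exact: (le_trans g0 gN).
rewrite ler_wpM2l//.
by rewrite /variance /dirichlet; have := lazy_apply_sqr f; lra.
Qed.

End Good.

(** * Variance decay and mixing along a list of matrices *)

Fixpoint good_seq (L : seq (V -> V -> R)) N : Prop :=
  if L is P :: L' then good P N /\ good_seq L' N else True.

Lemma good_seq_cat L1 L2 N : good_seq (L1 ++ L2) N <-> good_seq L1 N /\ good_seq L2 N.
Proof. by elim: L1 => [|P L1 IH] /=; [tauto|rewrite IH; tauto]. Qed.

Lemma good_seq_rcons L P N : good_seq (rcons L P) N <-> good P N /\ good_seq L N.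
Proof. by rewrite -cats1 good_seq_cat /=; tauto. Qed.

Lemma good_seq_rev L N : good_seq L N -> good_seq (rev L) N.
Proof. by elim: L => [//|P L IH] /= [gP /IH gL]; rewrite rev_cons good_seq_rcons. Qed.

(* By reversibility, one step of the chain acts on densities with respect to [pi]
   as the matrix itself. *)
Definition evolve (L : seq (V -> V -> R)) f := foldl (fun f P => apply_mx P f) f L.

Lemma evolve_ge0 L N f : good_seq L N -> (forall v, 0 <= f v) ->
  forall v, 0 <= evolve L f v.
Proof.
by elim: L f => [//|P L IH] f /= [gP gL] f0; exact: (IH _ gL (apply_fun_ge0 gP f0)).
Qed.

Lemma evolve_mean1 L N f : good_seq L N -> \sum_v pi v * f v = 1 ->
  \sum_v pi v * evolve L f v = 1.
Proof.
by elim: L f => [//|P L IH] f /= [gP gL] f0; exact: (IH _ gL (apply_mean1 gP f0)).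
Qed.

Lemma evolve_bounds L N f a b : good_seq L N -> (forall v, a <= f v <= b) ->
  forall v, a <= evolve L f v <= b.
Proof.
elim: L f => [//|P L IH] f /= [gP gL] fab; apply: IH => // v.
apply/andP; split; [apply: (apply_ge gP)|apply: (apply_le gP)] => u; by case/andP: (fab u).
Qed.

Lemma evolve_dotC L N f g : good_seq L N -> dot (evolve L f) g = dot f (evolve (rev L) g).
Proof.
elim: L f g => [//|P L IH] f g /= [gP gL].
rewrite IH// rev_cons -cats1 /evolve foldl_cat /= apply_dotC//.
by case: gP.
Qed.

(** Discrete version of the bound [N / k] for solutions of [V' = - V^2 / N]. If [x > N], the
    recursion would force [y < 0]. *)
Lemma quadratic_decay (k x y : R) N : 0 < N -> 0 <= k -> 0 <= x -> 0 <= y ->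
  x ^+ 2 <= N * (x - y) -> k * x <= N -> (k + 1) * y <= N.
Proof.
move=> N0 k0 x0 y0 xy kx; rewrite -(ler_pM2l N0).
have [xN|Nx] := lerP x N.
  have : k * x * (N - x) <= N * (N - x) by rewrite ler_wpM2r ?subr_ge0.
  have : (k + 1) * (N * y) <= (k + 1) * (N * x - x ^+ 2).
    by rewrite ler_wpM2l; lra.
  by have := sqr_ge0 x; lra.
have : N * y <= x * (N - x) by rewrite mulrBr -expr2; lra.
have : x * (N - x) < 0 by rewrite nmulr_llt0 ?subr_lt0//; lra.
have : 0 <= N * y by rewrite mulr_ge0// ltW.
lra.
Qed.

Lemma variance_ge0 f : \sum_v pi v * f v = 1 -> 0 <= variance f.
Proof. by move=> /varianceE ->; apply: dot_ge0. Qed.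

Lemma evolve_variance L N f : 0 < N -> good_seq L N -> (forall v, 0 <= f v) ->
  \sum_v pi v * f v = 1 -> (size L)%:R * variance (evolve L f) <= N.
Proof.
move=> N0 + f0 f1.
elim/last_ind: L => [_|L P IH]; first by rewrite mul0r ltW.
rewrite good_seq_rcons => -[gP gL].
rewrite size_rcons -cats1 /evolve foldl_cat /= -/(evolve L f) -natr1.
have e1 := evolve_mean1 gL f1; have e0 := evolve_ge0 gL f0.
apply: (quadratic_decay (x := variance (evolve L f))); rewrite ?ler0n ?variance_ge0//.
- exact: (apply_mean1 gP e1).
- exact: (variance_decay gP e0 e1).
- exact: IH.
Qed.

Definition point_density (x v : V) : R := (v == x)%:R / pi x.

Lemma mean_point_density x g : 0 < pi x -> \sum_v pi v * g v * point_density x v = g x.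
Proof.
move=> px; rewrite (bigD1 x)//= /point_density eqxx big1; last first.
  by move=> v /negPf ->; rewrite mul0r mulr0.
by rewrite addr0 mul1r mulrAC divff ?gt_eqF ?mul1r.
Qed.

(** Cut [L] into two halves of [2 n] rounds. By reversibility the value at [y] is the inner product
    of the density evolved from [x] through the first half with the one evolved from [y] through the
    reversed second half. Both have variance at most [1/2], so Cauchy-Schwarz for the centred
    densities gives a distance to [1] of at most [1/2]. *)
Lemma mixing L (n : nat) x y : (0 < n)%N -> good_seq L n%:R -> size L = (4 * n)%N ->
  (forall v, 0 < pi v) ->
  2^-1 <= evolve L (point_density x) y <= 3 / 2.
Proof.
move=> n0 gL sL pi_gt0.
have n0' : 0 < n%:R :> R by rewrite ltr0n.
have d0 z v : 0 <= point_density z v by rewrite divr_ge0.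
have d1 z : \sum_v pi v * point_density z v = 1.
  by rewrite -(mean_point_density (fun=> 1) (pi_gt0 z)); apply: eq_bigr => v _; rewrite mulr1.
rewrite -(cat_take_drop (2 * n) L) /evolve foldl_cat -!/(evolve _ _).
set L1 := take _ L; set L2 := drop _ L.
have [gL1 gL2] : good_seq L1 n%:R /\ good_seq L2 n%:R.
  by apply/good_seq_cat; rewrite cat_take_drop.
have sL1 : size L1 = (2 * n)%N by rewrite size_takel// sL leq_mul2r orbT.
have sL2 : size (rev L2) = (2 * n)%N by rewrite size_rev size_drop sL -mulnBl.
rewrite -(mean_point_density (evolve L2 _) (pi_gt0 y)) -/(dot _ _) (evolve_dotC _ _ gL2).
have half L' z : good_seq L' n%:R -> size L' = (2 * n)%N ->
    variance (evolve L' (point_density z)) <= 2^-1.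
  move=> gL' sL'; have := evolve_variance n0' gL' (d0 z) (d1 z).
  rewrite sL' natrM => H.
  rewrite -(ler_pM2l (_ : 0 < 2 * n%:R :> R)) ?mulr_gt0//.
  by apply: le_trans H _; rewrite mulrAC divff ?mul1r.
set f := evolve L1 _; set g := evolve (rev L2) _.
have gL2' := good_seq_rev gL2.
have f1 : \sum_v pi v * f v = 1 by exact: (evolve_mean1 gL1 (d1 x)).
have g1 : \sum_v pi v * g v = 1 by exact: (evolve_mean1 gL2' (d1 y)).
have E : dot f g - 1 = dot (fun v => f v - 1) (fun v => g v - 1).
  rewrite /dot (_ : \sum_v pi v * (f v - 1) * (g v - 1) =
    \sum_v pi v * f v * g v - \sum_v pi v * f v - \sum_v pi v * g v + \sum_v pi v).
    by rewrite f1 g1 pi_sum1; ring.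
  by rewrite -!sumrB -big_split /=; apply: eq_bigr => v _; ring.
have CS := dot_cauchy_schwarz (fun v => f v - 1) (fun v => g v - 1).
rewrite -E -!varianceE// in CS.
have Vf : variance f <= 2^-1 by exact: half.
have Vg : variance g <= 2^-1 by exact: half.
have Vf0 := variance_ge0 f1; have Vg0 := variance_ge0 g1.
have : (dot f g - 1) ^+ 2 <= 2^-1 ^+ 2.
  by apply: le_trans CS _; rewrite expr2 ler_pM.
by move: (dot f g) => d H; apply/andP; split; nra.
Qed.

(** * Walks killed at a moving target *)

Fixpoint killed (L : seq (V -> V -> R)) (h : seq V) f : V -> R :=
  match L, h with
  | P :: L', x :: h' => killed L' h' (kill x (apply_mx P f))
  | _, _ => f
  end.

Lemma killed_linear L h s f g :
  killed L h (fun v => f v + s * g v) = fun v => killed L h f v + s * killed L h g v.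
Proof.
elim: L h f g => [|P L IH] [|x h] f g //=; rewrite -IH; congr (killed _ _ _).
apply: funext => v; rewrite /kill; case: ifP => _; first by rewrite mulr0 addr0.
by rewrite /apply_mx mulr_sumr -big_split; apply: eq_bigr => u _; rewrite mulrDr mulrCA.
Qed.

Lemma killed_ge0 L N h f : good_seq L N -> (forall v, 0 <= f v) ->
  forall v, 0 <= killed L h f v.
Proof.
elim: L h f => [|P L IH] [|x h] f //= [gP gL] f0; apply: IH => // v.
by rewrite /kill; case: ifP => // _; exact: (apply_fun_ge0 gP f0 v).
Qed.

Lemma killed_mean_le L N h f : good_seq L N -> (forall v, 0 <= f v) ->
  \sum_v pi v * killed L h f v <= \sum_v pi v * f v.
Proof.
elim: L h f => [|P L IH] [|x h] f //= [gP gL] f0.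
have a0 := apply_fun_ge0 gP f0.
apply: le_trans (IH _ _ gL _) _; first by move=> v; rewrite /kill; case: ifP.
have [[P0 P1] _ Prev _] := gP; rewrite -(reversible_stationary P1 Prev f).
apply: ler_sum => v _; rewrite ler_wpM2l// /kill; by case: ifP.
Qed.

(** Each kill leaves a zero at the current target, which is what the next round needs in order to
    contract. *)
Lemma killed_dot_gap L N h f x : 1 <= N -> good_seq L N -> size h = size L -> f x = 0 ->
  dot (killed L h f) (killed L h f) <= ((1 - N^-1) ^+ size L) ^+ 2 * dot f f.
Proof.
move=> N1; elim: L h f x => [|P L IH] [|y h] f x //=.
  by rewrite expr0 expr1n mul1r.
move=> [gP gL] [sh] fx0.
have k0 : kill y (apply_mx P f) y = 0 by rewrite /kill eqxx.
apply: le_trans (IH _ _ _ gL sh k0) _.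
have -> : (1 - N^-1) ^+ (size L).+1 ^+ 2 * dot f f =
    (1 - N^-1) ^+ size L ^+ 2 * ((1 - N^-1) ^+ 2 * dot f f).
  by rewrite (exprSr _ (size L)); ring.
apply: ler_wpM2l; first exact: sqr_ge0.
exact: (killed_contraction_gap gP _ N1 fx0).
Qed.

(** The constant [1] vanishes nowhere: the first round only creates a zero, whence the exponent
    [(size L).-1]. Jensen's inequality passes from the mean to the L2 norm. *)
Lemma killed_mean1 L N h : 1 <= N -> good_seq L N -> size h = size L ->
  \sum_v pi v * killed L h (fun=> 1) v <= (1 - N^-1) ^+ (size L).-1.
Proof.
move=> N1; have lam0 : 0 <= 1 - N^-1 by rewrite subr_ge0 invf_le1//; lra.
case: L h => [|P L] [|y h] //=.
  by move=> _ _; rewrite (eq_bigr pi) ?pi_sum1// => v _; rewrite mulr1.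
move=> [gP gL] [sh].
set f := kill _ _.
rewrite -(@ler_pXn2r _ 2)// ?nnegrE ?exprn_ge0//; last first.
  apply: sumr_ge0 => v _; rewrite mulr_ge0// (killed_ge0 _ gL)// => u.
  by rewrite /f /kill; case: ifP => // _; apply: (apply_fun_ge0 gP).
apply: le_trans (jensen_sqr _ pi_ge0 pi_sum1) _.
rewrite (_ : \sum_v _ = dot (killed L h f) (killed L h f)); last first.
  by apply: eq_bigr => v _; rewrite expr2 mulrA.
have f0 : f y = 0 by rewrite /f /kill eqxx.
apply: le_trans (killed_dot_gap N1 gL sh f0) _.
rewrite -[leRHS]mulr1; apply: ler_wpM2l; first exact: sqr_ge0.
apply: le_trans (killed_contraction gP _ _) _.
by rewrite /dot (eq_bigr pi) ?pi_sum1// => v _; rewrite !mulr1.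
Qed.

(* For [a = c ^ 4] one of the bounds [3/2 a] and [(1 + a)/2] is at most [c]. *)
Lemma killed_mean L N h f m : 1 <= N -> good_seq L N -> size h = size L ->
  size L = (4 * m).+1 -> (forall v, 2^-1 <= f v <= 3 / 2) -> \sum_v pi v * f v = 1 ->
  \sum_v pi v * killed L h f v <= (1 - N^-1) ^+ m.
Proof.
move=> N1 gL sh sL fb f1.
have lam0 : 0 <= 1 - N^-1 by rewrite subr_ge0 invf_le1//; lra.
have lam1 : 1 - N^-1 <= 1 by rewrite gerBl invr_ge0; lra.
have := killed_mean1 N1 gL sh; rewrite sL /= mulnC exprM.
set c := (1 - N^-1) ^+ m => a_le.
have c0 : 0 <= c by exact: exprn_ge0.
have c1 : c <= 1 by exact: exprn_ile1.
set a := \sum_v _ in a_le.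
have meanE s g : \sum_v pi v * killed L h (fun v => g v + s * 1) v =
    \sum_v pi v * killed L h g v + s * a.
  rewrite (killed_linear _ _ s g (fun=> 1)) mulr_sumr -big_split /=.
  by apply: eq_bigr => v _; ring.
have up : \sum_v pi v * killed L h f v <= 3 / 2 * a.
  have : 0 <= \sum_v pi v * killed L h (fun v => 3 / 2 - f v) v.
    apply: sumr_ge0 => v _; rewrite mulr_ge0// (killed_ge0 _ gL)// => u.
    by have /andP[] := fb u; lra.
  have -> : (fun v => 3 / 2 - f v) = (fun v => (fun v => 0 + -1 * f v) v + 3 / 2 * 1).
    by apply: funext => v; ring.
  rewrite meanE killed_linear.
  under eq_bigr do rewrite mulrDr.
  rewrite big_split /=.
  have -> : \sum_i pi i * killed L h (fun=> 0) i = 0.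
    have := killed_linear L h (-1) (fun=> 0) (fun=> 0).
    rewrite (_ : (fun v => 0 + -1 * 0) = (fun=> 0)); last by apply: funext => v; ring.
    move=> K; apply: big1 => v _; rewrite K; ring.
  rewrite add0r; under eq_bigr do rewrite mulN1r mulrN.
  by rewrite sumrN; lra.
have down : \sum_v pi v * killed L h f v <= 2^-1 + 2^-1 * a.
  have -> : f = (fun v => (f v - 2^-1) + 2^-1 * 1) by apply: funext => v; ring.
  rewrite meanE lerD2r; apply: le_trans (killed_mean_le _ gL _) _.
    by move=> v; have /andP[] := fb v; lra.
  under eq_bigr do rewrite mulrBr.
  by rewrite sumrB f1 -mulr_suml pi_sum1; lra.
(* The bound must carry no constant factor, since it is later raised to the number of killed
   walkers. Below [3/5], [3/2 c^3 <= 1]; above, [2 c - 1 - c^4 = (1 - c) (c^3 + c^2 + c - 1) >=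
   0]. *)
have [c6|/ltW c6] := lerP c (3 / 5).
  apply: le_trans up _; apply: le_trans (_ : 3 / 2 * c ^+ 4 <= _); first lra.
  have c3 : c ^+ 3 <= (3 / 5) ^+ 3 by rewrite lerXn2r ?nnegrE//; lra.
  have : c * c ^+ 3 <= c * (3 / 5) ^+ 3 by rewrite ler_wpM2l.
  lra.
apply: le_trans down _; apply: le_trans (_ : 2^-1 + 2^-1 * c ^+ 4 <= _); first lra.
have c3 : (3 / 5) ^+ 3 <= c ^+ 3 by rewrite lerXn2r ?nnegrE//; lra.
have c2 : (3 / 5) ^+ 2 <= c ^+ 2 by rewrite lerXn2r ?nnegrE//; lra.
have : 0 <= (1 - c) * (c ^+ 3 + c ^+ 2 + c - 1) by rewrite mulr_ge0 ?subr_ge0//; lra.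
lra.
Qed.

End ReversibleChain.

(** * Coalescing walks *)

Section Walkers.
Context {R : realFieldType} {V I : finType}.
Implicit Types (P : V -> V -> R) (w z : {ffun I -> V}) (L : seq (V -> V -> R)).

Definition move_prob P w z : R := \prod_i P (w i) (z i).

Definition stochastic P := (forall u v, 0 <= P u v) /\ (forall u, \sum_v P u v = 1).

Lemma move_prob_ge0 P w z : stochastic P -> 0 <= move_prob P w z.
Proof. by move=> [P0 _]; apply: prodr_ge0. Qed.

Lemma move_prob_sum1 P w : stochastic P -> \sum_z move_prob P w z = 1.
Proof. by move=> [_ P1]; rewrite -(bigA_distr_bigA (fun i v => P (w i) v)) big1. Qed.

Fixpoint expect L (G : {ffun I -> V} -> R) w : R :=
  if L is P :: L' then \sum_z move_prob P w z * expect L' G z else G w.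

(* [never_meets L J i w] is the probability that walker [i] meets no walker of [J]
   during the rounds [L], for independent walkers started at [w]. *)
Fixpoint never_meets L (J : {set I}) (i : I) w : R :=
  if L is P :: L' then
    \sum_z move_prob P w z * ((z i \notin z @: J)%:R * never_meets L' J i z)
  else 1.

End Walkers.

Section Coalescence.
Context {R : realFieldType} {V : finType}.
Variables (pi : V -> R) (N : R).
Implicit Types (P : V -> V -> R) (S : {set V}) (L : seq (V -> V -> R)).

(* [coal L S] is the probability that coalescing walks started from all the vertices
   of [S] have not merged into a single walk after the rounds [L]; in a round,
   [y u] is the common destination of the walks at [u]. *)
Fixpoint coal L S : R :=
  if L is P :: L' then
    \sum_(y : {ffun V -> V}) move_prob P [ffun u => u] y * coal L' (y @: S)
  else (1 < #|S|)%:R.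

Fixpoint stochastic_seq L : Prop :=
  if L is P :: L' then stochastic P /\ stochastic_seq L' else True.

Lemma good_stochastic P : good pi P N -> stochastic P.
Proof. by case. Qed.

Lemma good_stochastic_seq L : good_seq pi L N -> stochastic_seq L.
Proof. by elim: L => //= P L IH [/good_stochastic gP /IH]. Qed.

Lemma coal_bounds L S : stochastic_seq L -> 0 <= coal L S <= 1.
Proof.
elim: L S => [|P L IH] S /=; first by case: (_ < _)%N; rewrite ?ler01 ?lexx.
move=> [sP sL]; apply/andP; split.
  apply: sumr_ge0 => y _; rewrite mulr_ge0 ?move_prob_ge0//.
  by have /andP[] := IH (y @: S) sL.
rewrite -[leRHS](move_prob_sum1 [ffun u => u] sP); apply: ler_sum => y _.
rewrite -[leRHS]mulr1 ler_wpM2l ?move_prob_ge0//.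
by have /andP[] := IH (y @: S) sL.
Qed.

Lemma coal_mono L S S' : stochastic_seq L -> S \subset S' -> coal L S <= coal L S'.
Proof.
elim: L S S' => [|P L IH] S S' /=.
  move=> _ /subset_leq_card SS'; rewrite ler_nat.
  by case: ltnP => // S1; rewrite (leq_trans S1 SS').
move=> [sP sL] SS'; apply: ler_sum => y _.
by rewrite ler_wpM2l ?move_prob_ge0// IH// imsetS.
Qed.

Lemma coal_small L S : (#|S| <= 1)%N -> coal L S = 0.
Proof.
elim: L S => [|P L IH] S /= S1; first by rewrite ltnNge S1.
by rewrite big1// => y _; rewrite IH ?mulr0// (leq_trans (leq_imset_card _ _)).
Qed.

(** If the walks have not merged during [L1], those that remain are among the walks restarted from
    all vertices. *)
Lemma coal_cat L1 L2 S : stochastic_seq L1 -> stochastic_seq L2 ->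
  coal (L1 ++ L2) S <= coal L1 S * coal L2 [set: V].
Proof.
elim: L1 S => [|P L1 IH] S /= sL1 sL2.
  have [S1|S1] := ltnP 1 #|S|; first by rewrite mul1r coal_mono ?finset.subsetT.
  by rewrite coal_small// mul0r.
rewrite mulr_suml; apply: ler_sum => y _; rewrite -mulrA.
by case: sL1 => sP sL1; rewrite ler_wpM2l ?move_prob_ge0 ?IH.
Qed.

Section Domination.
Context {I : finType}.
Implicit Types (w z : {ffun I -> V}) (A J : {set I}).

(* The walks at the vertices of [w @: A] may follow one walker of [A] each: exchanging
   the moves of these walkers with those of the vertices preserves the law. *)
Lemma coal_step P L w A : stochastic P -> stochastic_seq L ->
  coal (P :: L) (w @: A) <= \sum_z move_prob P w z * coal L (z @: A).
Proof.
move=> sP sL.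
have [->|/set0Pn[i0 _]] := eqVneq A finset.set0.
  rewrite imset0 coal_small ?cards0//; apply: sumr_ge0 => z _.
  by rewrite mulr_ge0 ?move_prob_ge0//; have /andP[] := coal_bounds (z @: finset.set0) sL.
set S := w @: A.
(* [s u] is a walker of [A] chosen to represent the vertex [u], with [i0] as default value; [T]
   below singles out the chosen walkers. *)
pose s u := odflt i0 [pick i in A | w i == u].
have sP1 u : u \in S -> s u \in A /\ w (s u) = u.
  move=> /imsetP[i iA uE]; rewrite /s; case: pickP => [j /andP[jA /eqP]//|/(_ i)].
  by rewrite iA uE eqxx.
pose T i := (w i \in S) && (s (w i) == i).
(* [sw] exchanges the destination of each vertex of [S] with that of its representative. Both start
   from the same vertex, so the product weight [W] is unchanged. *)
pose sw (p : {ffun V -> V} * {ffun I -> V}) : {ffun V -> V} * {ffun I -> V} :=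
  ([ffun u => if u \in S then p.2 (s u) else p.1 u],
   [ffun i => if T i then p.1 (w i) else p.2 i]).
have swK : involutive sw.
  move=> [y z]; rewrite /sw /=; congr (_, _); apply/ffunP => x; rewrite !ffunE.
    by case: ifP => xS; rewrite ?xS//; have [_ wsx] := sP1 x xS; rewrite /T wsx xS eqxx.
  by case: ifP => Tx; rewrite ?Tx//; case/andP: Tx => wS /eqP sE; rewrite wS sE.
pose W p := move_prob P [ffun u => u] p.1 * move_prob P w p.2.
have Wsw p : W (sw p) = W p.
  have reix (F : V -> R) : \prod_(u in S) F u = \prod_(i | T i) F (w i).
    by rewrite (reindex_onto w s)// => u /sP1[].
  rewrite /W /move_prob (bigID [in S])/= [X in _ * X](bigID T)/=.
  rewrite [in RHS](bigID [in S])/= [X in _ = _ * X](bigID T)/=.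
  rewrite !reix.
  rewrite [X in X * _ * _](_ : _ = \prod_(i | T i) P (w i) (p.2 i)); last first.
    by apply: eq_bigr => i /andP[wS /eqP sE]; rewrite !ffunE wS sE.
  rewrite [X in _ * X * _](_ : _ =
      \prod_(i | i \notin S) P ([ffun u => u] i) (p.1 i)); last first.
    by apply: eq_bigr => u /negPf uS; rewrite !ffunE uS.
  rewrite [X in _ * (X * _)](_ : _ =
      \prod_(i | T i) P ([ffun u => u] (w i)) (p.1 (w i))); last first.
    by apply: eq_bigr => i Ti; rewrite !ffunE Ti.
  rewrite [X in _ * (_ * X)](_ : _ = \prod_(i | ~~ T i) P (w i) (p.2 i)); last first.
    by apply: eq_bigr => i /negPf Ti; rewrite !ffunE Ti.
  ring.
have -> : coal (P :: L) S = \sum_p W p * coal L (p.1 @: S).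
  rewrite -(pair_bigA _ (fun y z => W (y, z) * coal L (y @: S)))/=.
  apply: eq_bigr => y _; rewrite -mulr_suml; congr (_ * _).
  by rewrite /W /= -mulr_sumr move_prob_sum1 ?mulr1.
have -> : \sum_z move_prob P w z * coal L (z @: A) = \sum_p W p * coal L (p.2 @: A).
  rewrite -(pair_bigA _ (fun y z => W (y, z) * coal L (z @: A)))/= exchange_big.
  apply: eq_bigr => z _; rewrite -mulr_suml; congr (_ * _).
  by rewrite /W /= -mulr_suml move_prob_sum1 ?mul1r.
rewrite (reindex_inj (inv_inj swK)) /=; apply: ler_sum => p _.
rewrite Wsw ler_wpM2l//; first by rewrite mulr_ge0 ?move_prob_ge0.
apply: coal_mono => //; apply/fintype.subsetP => v /imsetP[u uS ->].
by rewrite ffunE uS; apply: imset_f; have [] := sP1 u uS.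
Qed.

(* A walker of [A :\: J] that meets [J] is removed; the walkers of [J] do not
   interact. *)
Lemma coal_phase L L' w A J : stochastic_seq L -> stochastic_seq L' -> J \subset A ->
  coal (L ++ L') (w @: A) <=
  \sum_(i in A :\: J) never_meets L J i w + expect L (fun z => coal L' (z @: J)) w.
Proof.
move=> + sL'; elim: L w A => [|P L IH] w A.
  move=> _ JA /=; have [AJ0|[i iAJ]] := set_0Vmem (A :\: J).
    have /eqP -> : A == J by rewrite finset.eqEsubset JA andbT -finset.setD_eq0 AJ0.
    by rewrite finset.setDv big_set0 add0r.
  have /andP[_ c1] := coal_bounds (w @: A) sL'.
  have /andP[c0 _] := coal_bounds (w @: J) sL'.
  rewrite sumr_const; apply: le_trans c1 _; apply: le_trans (_ : #|A :\: J|%:R <= _).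
    by rewrite ler1n card_gt0; apply/set0Pn; exists i.
  by rewrite lerDl.
move=> [sP sL] JA /=; apply: (le_trans (coal_step _ _ sP _)).
  by elim: (L) sL => //= Q M IHM [sQ /IHM].
rewrite exchange_big /= -big_split /=; apply: ler_sum => z _.
rewrite -mulr_sumr -mulrDr ler_wpM2l ?move_prob_ge0//.
(* Dropping the walkers that have just met [J] leaves the set of occupied vertices unchanged. *)
pose A' := [set i in A | (i \in J) || (z i \notin z @: J)].
have JA' : J \subset A'.
  by apply/fintype.subsetP => i iJ; rewrite inE iJ (fintype.subsetP JA).
have zA : z @: A = z @: A'.
  apply/eqP; rewrite finset.eqEsubset; apply/andP; split; last first.
    by apply/imsetS/fintype.subsetP => i; rewrite inE => /andP[].
  apply/fintype.subsetP => v /imsetP[i iA ->].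
  have [/imsetP[j jJ ->]|zJ] := boolP (z i \in z @: J).
    exact/imset_f/(fintype.subsetP JA').
  by apply: imset_f; rewrite inE iA zJ orbT.
rewrite zA; apply: le_trans (IH _ _ sL JA') _; rewrite lerD2r.
rewrite le_eqVlt; apply/orP; left; apply/eqP.
rewrite [RHS](bigID (fun i => z i \in z @: J)) /= [X in _ = X + _]big1 ?add0r; last first.
  by move=> i /andP[_ ->]; rewrite mul0r.
apply: eq_big => i; rewrite !inE; first by case: (i \in J).
by move=> /and3P[/negPf -> _ /= ->]; rewrite mul1r.
Qed.

End Domination.
End Coalescence.

(** * Independent walkers with given densities *)

Section ProductAverages.
Context {R : realFieldType} {V I : finType}.
Variables (pi : V -> R) (N : R).
Hypotheses (pi_ge0 : forall v, 0 <= pi v) (pi_sum1 : \sum_v pi v = 1).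
Implicit Types (L : seq (V -> V -> R)) (w z : {ffun I -> V}).
Implicit Types (phi : I -> V -> R) (G : {ffun I -> V} -> R) (J : {set I}).

(* The mean of [G] when the positions are independent with densities [phi i]. *)
Definition average phi G : R := \sum_(w : {ffun I -> V}) (\prod_i (pi (w i) * phi i (w i))) * G w.

Lemma average_le phi G G' : (forall i v, 0 <= phi i v) -> (forall w, G w <= G' w) ->
  average phi G <= average phi G'.
Proof.
move=> phi0 GG'; apply: ler_sum => w _; apply: ler_wpM2l => //.
by apply: prodr_ge0 => i _; rewrite mulr_ge0.
Qed.

Lemma average_add phi G G' :
  average phi (fun w => G w + G' w) = average phi G + average phi G'.
Proof. by rewrite -big_split; apply: eq_bigr => w _; rewrite mulrDr. Qed.

Lemma average_sum (T : finType) (D : {pred T}) phi (G : T -> {ffun I -> V} -> R) :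
  average phi (fun w => \sum_(t in D) G t w) = \sum_(t in D) average phi (G t).
Proof. by rewrite exchange_big; apply: eq_bigr => w _; rewrite mulr_sumr. Qed.

Lemma average1 phi : average phi (fun=> 1) = \prod_i \sum_v pi v * phi i v.
Proof.
by rewrite (bigA_distr_bigA (fun i v => pi v * phi i v)); apply: eq_bigr => w _; rewrite mulr1.
Qed.

(** By reversibility [pi u * P u v] becomes [pi v * P v u], so summing out each starting position
    applies [P] to the density of that walker. Independent moves preserve the product form. *)
Lemma average_move P phi G : good pi P N ->
  average phi (fun w => \sum_z move_prob P w z * G z) =
  average (fun i => apply_mx P (phi i)) G.
Proof.
move=> gP; have [_ _ Prev _] := gP.
rewrite /average; under eq_bigr do rewrite mulr_sumr.
rewrite exchange_big; apply: eq_bigr => z _ /=.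
under eq_bigr do rewrite mulrA; rewrite -mulr_suml; congr (_ * _).
have E w : \prod_i (pi (w i) * phi i (w i)) * move_prob P w z =
    \prod_i (pi (w i) * phi i (w i) * P (w i) (z i)) by rewrite [RHS]big_split.
rewrite (eq_bigr _ (fun w _ => E w)).
rewrite -(bigA_distr_bigA (fun i u => pi u * phi i u * P u (z i))).
apply: eq_bigr => i _; rewrite mulr_sumr; apply: eq_bigr => u _.
by rewrite mulrAC Prev mulrA.
Qed.

Lemma average_expect L phi G : good_seq pi L N ->
  average phi (expect L G) = average (fun i => evolve L (phi i)) G.
Proof.
elim: L phi => [//|P L IH] phi /= [gP gL].
by rewrite average_move// IH.
Qed.

Lemma average_point (w : {ffun I -> V}) G : (forall v, 0 < pi v) ->
  average (fun i => point_density pi (w i)) G = G w.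
Proof.
move=> pi_gt0; rewrite /average (bigD1 w)//= [X in _ + X]big1 ?addr0; last first.
  move=> z /eqP zw; have [i zwi] : exists i, z i != w i.
    by apply/existsP/contraT => /existsPn E; case: zw; apply/ffunP => i; apply/eqP/negbNE/E.
  by rewrite (bigD1 i)//= /point_density (negPf zwi) mul0r mulr0 !mul0r.
rewrite big1 ?mul1r// => i _; rewrite /point_density eqxx mul1r divff//.
by rewrite gt_eqF.
Qed.

(* Conditioning on the position of walker [i], the walkers of [J] are killed there
   independently of one another. *)
Lemma average_never_meets L phi J i (b : R) : good_seq pi L N ->
  (forall k v, 0 <= phi k v) -> (forall k, k != i -> \sum_v pi v * phi k v <= 1) ->
  i \notin J -> 0 <= b ->
  (forall h j, size h = size L -> j \in J -> \sum_v pi v * killed L h (phi j) v <= b) ->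
  average phi (never_meets L J i) <= (\sum_v pi v * phi i v) * b ^+ #|J|.
Proof.
move=> + + + iJ b0.
elim: L phi => [|P L IH] phi.
  move=> _ phi0 phi1 phib /=; rewrite average1 (bigD1 i)//=.
  apply: ler_wpM2l; first by apply: sumr_ge0 => v _; rewrite mulr_ge0.
  have m0 k : 0 <= \sum_v pi v * phi k v by apply: sumr_ge0 => v _; rewrite mulr_ge0.
  rewrite (bigID [in J])/= -[leRHS]mulr1; apply: ler_pM.
  - by apply: prodr_ge0.
  - by apply: prodr_ge0.
  - rewrite -prodr_const.
    rewrite (eq_bigl [in J]); last first.
      by move=> k; case: (k \in J) (memPn iJ k) => [->//|_]; rewrite andbF.
    apply: ler_prod => k kJ; rewrite m0 /=.
    exact: (phib [::] k erefl kJ).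
  - by apply: Num.Theory.prodr_ile1 => k /andP[ki _]; rewrite m0 phi1.
move=> /= [gP gL] phi0 phi1 phib.
have [[_ P1] _ Prev _] := gP; rewrite average_move//.
(* The densities when walker [i] arrives at [v]: its own is restricted to [v], those of [J] are
   killed at [v], the others are untouched. Summed over [v], the masses of walker [i] add up to its
   mass before the move. *)
pose psi v k := if k == i then (fun u => (u == v)%:R * apply_mx P (phi i) u)
  else if k \in J then kill v (apply_mx P (phi k)) else apply_mx P (phi k).
have a0 k v : 0 <= apply_mx P (phi k) v by exact: (apply_fun_ge0 gP).
have -> : average (fun k => apply_mx P (phi k))
    (fun z => (z i \notin z @: J)%:R * never_meets L J i z) =
    \sum_v average (psi v) (never_meets L J i).
  rewrite /average exchange_big; apply: eq_bigr => z _ /=.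
  rewrite -mulr_suml mulrA; congr (_ * _).
  rewrite (bigD1 (z i))//= [X in _ = _ + X]big1 ?addr0; last first.
    move=> v /negPf vz; rewrite (bigD1 i)//= /psi eqxx eq_sym vz.
    by rewrite mul0r mulr0 mul0r.
  have [/imsetP[j jJ zij]|zJ] := boolP (z i \in z @: J).
    have psi0 : psi (z i) j (z j) = 0.
      by rewrite /psi (negPf (memPn iJ j jJ)) jJ zij /kill eqxx.
    by rewrite (_ : (~~ true)%:R = 0)// [RHS](bigD1 j)//= psi0 !mulr0 mul0r.
  rewrite (_ : (~~ false)%:R = 1)// mulr1; apply: eq_bigr => k _; congr (_ * _); rewrite /psi.
  have [->|ki] := eqVneq k i; first by rewrite eqxx mul1r.
  case: ifP => // kJ; rewrite /kill; case: eqP => // zk.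
  by move: zJ; rewrite -zk imset_f.
rewrite -(reversible_stationary P1 Prev (phi i)).
rewrite mulr_suml; apply: ler_sum => v _.
have -> : pi v * apply_mx P (phi i) v = \sum_u pi u * psi v i u.
  rewrite (bigD1 v)//= /psi !eqxx mul1r big1 ?addr0// => u /negPf ->.
  by rewrite mul0r mulr0.
apply: IH => //.
- move=> k u; rewrite /psi; case: ifP => _; first by rewrite mulr_ge0.
  by case: ifP => _ //; rewrite /kill; case: ifP.
- move=> k ki; apply: le_trans (phi1 _ ki).
  rewrite -(reversible_stationary P1 Prev (phi k)).
  apply: ler_sum => u _; rewrite ler_wpM2l// /psi (negPf ki).
  by case: ifP => // _; rewrite /kill; case: ifP.
- move=> h j sh jJ; rewrite /psi (negPf (memPn iJ j jJ)) jJ.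
  by apply: (phib (v :: h) j) => //=; rewrite sh.
Qed.

End ProductAverages.

(** * Phase lengths and the probability of coalescence *)

Definition phase_time n r := ((3 * n * r.+1) %/ 2 ^ r).+1.

(** A phase of [4 m + 1] rounds is what [killed_mean] needs to yield [(1 - 1/n)^m]. Phases run from
    index [r - 1] down to [0]. *)
Fixpoint phases_length n r : nat :=
  if r is r'.+1 then ((4 * phase_time n r').+1 + phases_length n r')%N else 0%N.

Lemma phases_length_le n r : (phases_length n r <= 5 * r + 48 * n)%N.
Proof.
(* [4 - (2 r + 4) / 2^r] is the sum of [(s + 1) / 2^s] over [s < r]. The successors in the two
   definitions cost at most [5] rounds per phase. *)
suff : (phases_length n r)%:R <= 5 * r%:R + 12 * n%:R * (4 - (2 * r%:R + 4) / 2 ^+ r) :> rat.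
  move=> H; rewrite -(ler_nat rat) natrD !natrM; apply: le_trans H _.
  have : 0 <= n%:R * ((2 * r%:R + 4) / 2 ^+ r) :> rat.
    by rewrite mulr_ge0// divr_ge0 ?exprn_ge0// addr_ge0 ?mulr_ge0.
  by lra.
elim: r => [|r IH] /=; first by rewrite expr0; lra.
have : (phase_time n r)%:R <= 3 * n%:R * (r%:R + 1) / 2 ^+ r + 1 :> rat.
  rewrite /phase_time -natr1 lerD2r ler_pdivlMr ?exprn_gt0// -natrX -natrM.
  by rewrite natr1 -!natrM ler_nat leq_trunc_div.
rewrite natrD -(natr1 (4 * phase_time n r)%N) natrM -(natr1 r) exprS.
have q0 : 2 ^+ r != 0 :> rat by rewrite expf_neq0.
have -> : (2 * (r%:R + 1) + 4) / (2 * 2 ^+ r) = (r%:R + 3) / 2 ^+ r :> rat by field.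
move: IH; rewrite !mulrDl !mul1r.
lra.
Qed.

(* Walkers started at the vertices are first mixed during [4 n] rounds. *)
Definition coalescence_length (V : finType) n := (4 * n + phases_length n #|V|)%N.

(** Here [4 n + 48 n + 5 (n + 1) <= 62 n]. *)
Lemma coalescence_length_le (V : finType) n : (0 < n)%N -> (#|V| <= n.+1)%N ->
  (coalescence_length V n <= 62 * n)%N.
Proof.
by move=> n0 Vn; have := phases_length_le n #|V|; rewrite /coalescence_length; lia.
Qed.

Section CoalescenceTime.
Context {R : realFieldType} {V : finType}.
Variables (pi : V -> R) (n : nat).
Hypotheses (pi_ge0 : forall v, 0 <= pi v) (pi_sum1 : \sum_v pi v = 1) (n_gt0 : (0 < n)%N).
Implicit Types (L : seq (V -> V -> R)).

Lemma bernoulli_ge (x : R) k : 0 <= x -> 1 + k%:R * x <= (1 + x) ^+ k.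
Proof.
move=> x0; elim: k => [|k IH]; first by rewrite mul0r addr0 expr0.
rewrite exprS; apply: le_trans (_ : (1 + x) * (1 + k%:R * x) <= _); last first.
  by rewrite ler_wpM2l// addr_ge0.
rewrite -natr1; have : 0 <= k%:R * x * x by rewrite !mulr_ge0.
by lra.
Qed.

Let lam : R := 1 - n%:R^-1.

Let n_ge1 : 1 <= n%:R :> R. Proof. by rewrite ler1n. Qed.

Let lam_ge0 : 0 <= lam.
Proof. by rewrite subr_ge0 invf_le1//; apply: lt_le_trans n_ge1. Qed.

Let lam_le1 : lam <= 1. Proof. by rewrite gerBl invr_ge0. Qed.

(** The product [(1 - 1/n)^n (1 + 1/n)^n] is at most [1], and its second factor is at least [2] by
    Bernoulli's inequality. *)
Lemma lam_exp_half : lam ^+ n <= 2^-1.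
Proof.
have n0 : 0 < n%:R :> R by rewrite ltr0n.
have two : 2 <= (1 + n%:R^-1) ^+ n :> R.
  apply: le_trans (bernoulli_ge n _); last by rewrite invr_ge0.
  by rewrite divff ?gt_eqF//; lra.
have : lam ^+ n * (1 + n%:R^-1) ^+ n <= 1.
  rewrite -exprMn; apply: exprn_ile1.
    by rewrite mulr_ge0// addr_ge0// invr_ge0.
  by rewrite /lam -subr_sqr expr1n gerBl sqr_ge0.
have : lam ^+ n * 2 <= lam ^+ n * (1 + n%:R^-1) ^+ n by rewrite ler_wpM2l ?exprn_ge0.
lra.
Qed.

(** At least [3 n (r + 1)] factors [lam] give [8^-(r + 1)], which beats the [2^r] walkers to be
    removed and leaves a summable bound. *)
Lemma phase_failure r : 2 ^+ r * lam ^+ (phase_time n r * 2 ^ r) <= 8^-1 * 4^-1 ^+ r.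
Proof.
have ge_m : (3 * n * r.+1 <= phase_time n r * 2 ^ r)%N.
  by rewrite /phase_time ltnW// ltn_ceil// expn_gt0.
apply: le_trans (_ : 2 ^+ r * (2^-1 ^+ 3) ^+ r.+1 <= _).
  apply: ler_wpM2l; first exact: exprn_ge0.
  apply: le_trans (_ : lam ^+ (3 * n * r.+1) <= _); first exact: ler_wiXn2l.
  rewrite mulnAC [(_ * n)%N]mulnC 2!exprM -exprM -(exprM (2^-1)).
  by rewrite lerXn2r ?nnegrE ?exprn_ge0// lam_exp_half.
rewrite exprS mulrCA -exprMn.
have e8 : 2^-1 ^+ 3 = 8^-1 :> R by field.
have e4 : 2 * 8^-1 = 4^-1 :> R by field.
by rewrite e8 e4.
Qed.

(** The bound is the sum of [8^-1 4^-s] over [s < r], one failure probability per phase. The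
    hypotheses on the densities are preserved by [evolve], so they hold again when the next phase
    starts. *)
Lemma phases_coal {I : finType} r (A : {set I}) L (phi : I -> V -> R) :
  (#|A| <= 2 ^ r)%N -> good_seq pi L n%:R -> size L = phases_length n r ->
  (forall i v, 2^-1 <= phi i v <= 3 / 2) -> (forall i, \sum_v pi v * phi i v = 1) ->
  average pi phi (fun w => coal L (w @: A)) <= 6^-1 * (1 - 4^-1 ^+ r).
Proof.
elim: r A L phi => [|r IH] A L phi Ar gL sL phib phi1.
  rewrite expr0 subrr mulr0 /average big1// => w _.
  by rewrite coal_small ?mulr0// (leq_trans (leq_imset_card _ _)).
(* [J] is all of [A] if that is already small enough, and otherwise [2^r] of its walkers, which
   leaves at most [2^r] to be removed. *)
have [J [JA Jr Jc]] : exists J : {set I}, [/\ J \subset A, (#|J| <= 2 ^ r)%N &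
    forall c : R, 0 <= c -> #|A :\: J|%:R * c ^+ #|J| <= 2 ^+ r * c ^+ (2 ^ r)].
  have [A_le|A_gt] := leqP #|A| (2 ^ r).
    exists A; split => // c c0.
    by rewrite finset.setDv cards0 mul0r mulr_ge0 ?exprn_ge0.
  have /card_geqP[s [us ss sA]] := ltnW A_gt.
  have JA : [set x in s] \subset A by apply/fintype.subsetP => x; rewrite inE => /sA.
  have cJ : #|[set x in s]| = (2 ^ r)%N by rewrite cardsE; move/card_uniqP: us => ->.
  exists [set x in s]; split; rewrite ?cJ// => c c0.
  rewrite ler_wpM2r ?exprn_ge0// -natrX ler_nat cardsD (finset.setIidPr JA) cJ.
  by rewrite leq_subLR addnn -mul2n -expnS.
have phi0 i v : 0 <= phi i v by have /andP[h _] := phib i v; apply: le_trans h.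
rewrite -(cat_take_drop (4 * phase_time n r).+1 L) in gL *.
have sL1 : size (take (4 * phase_time n r).+1 L) = (4 * phase_time n r).+1.
  by rewrite size_takel// sL leq_addr.
have sL2 : size (drop (4 * phase_time n r).+1 L) = phases_length n r.
  by rewrite size_drop sL addKn.
move: (take _ L) (drop _ L) gL sL1 sL2 => L1 L2 /good_seq_cat[gL1 gL2] sL1 sL2.
apply: le_trans (average_le pi_ge0 phi0 (fun w => coal_phase w
  (good_stochastic_seq gL1) (good_stochastic_seq gL2) JA)) _.
rewrite average_add average_sum (average_expect _ _ gL1).
have := IH J L2 (fun i => evolve L1 (phi i)) Jr gL2 sL2
  (fun i => evolve_bounds gL1 (phib i)) (fun i => evolve_mean1 gL1 (phi1 i)).
set c := lam ^+ phase_time n r.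
have c0 : 0 <= c by apply: exprn_ge0.
have : \sum_(i in A :\: J) average pi phi (never_meets L1 J i) <= #|A :\: J|%:R * c ^+ #|J|.
  rewrite mulr_natl -sumr_const; apply: ler_sum => i; rewrite inE => /andP[iJ _].
  rewrite -[leRHS]mul1r -[X in _ <= X * _](phi1 i).
  apply: (average_never_meets pi_ge0 gL1) => //; first by move=> k _; rewrite phi1.
  move=> h j sh jJ; exact: (killed_mean pi_ge0 pi_sum1 n_ge1 gL1 sh sL1 (phib j) (phi1 j)).
have := Jc c c0; have := phase_failure r; rewrite exprM -/c exprS.
have : 0 <= 4^-1 ^+ r :> R by apply: exprn_ge0.
lra.
Qed.

Lemma coal_half L : (forall v, 0 < pi v) -> good_seq pi L n%:R ->
  size L = coalescence_length V n -> coal L [set: V] <= 2^-1.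
Proof.
move=> pi_gt0 gL sL; rewrite -(cat_take_drop (4 * n) L) in gL *.
have sL1 : size (take (4 * n) L) = (4 * n)%N by rewrite size_takel// sL leq_addr.
have sL2 : size (drop (4 * n) L) = phases_length n #|V| by rewrite size_drop sL addKn.
move: (take _ L) (drop _ L) gL sL1 sL2 => L1 L2 /good_seq_cat[gL1 gL2] sL1 sL2.
pose w := [ffun u : V => u].
have -> : [set: V] = w @: [set: V].
  by apply/setP => v; rewrite !inE; apply/esym/imsetP; exists v; rewrite ?ffunE ?inE.
(* With [J = A], no walker is removed while the walks mix. *)
apply: le_trans (coal_phase w (good_stochastic_seq gL1) (good_stochastic_seq gL2)
  (fintype.subxx _)) _.
rewrite finset.setDv big_set0 add0r -(average_point w _ pi_gt0).
rewrite (average_expect _ _ gL1).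
(* The crude choice [r = #|V|] works since [#|V| < 2^#|V|]; it costs [O(n)] rounds, as [card_le_hit]
   bounds [#|V|]. *)
apply: le_trans (phases_coal (r := #|V|) _ gL2 sL2 _ _) _.
- by rewrite cardsT ltnW// ltn_expl.
- move=> i v; exact: (mixing pi_ge0 pi_sum1 _ _ n_gt0 gL1 sL1 pi_gt0).
- move=> i; apply: (evolve_mean1 gL1).
  rewrite -[RHS](mean_point_density (fun=> 1) (pi_gt0 (w i))).
  by apply: eq_bigr => v _; rewrite mulr1.
have : 0 <= 4^-1 ^+ #|V| :> R by apply: exprn_ge0.
lra.
Qed.

End CoalescenceTime.

Local Open Scope classical_set_scope.
Local Open Scope ring_scope.

(** * Expected first times *)

Section FirstTime.
Context {R : realType}.

Definition not_yet (A : set nat) : set nat := [set t | forall s, (s <= t)%N -> ~ A s].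

Lemma partial_sum_not_yet (A : set nat) (n : nat) :
  (forall t, A t -> (n <= t)%N) ->
  (\sum_(0 <= t < n) (\1_(not_yet A) t)%:E = n%:R%:E :> \bar R)%E.
Proof.
move=> An; rewrite (eq_big_nat _ _ (F2 := fun=> 1%E)); last first.
  move=> t /andP[_ tn]; rewrite indicE mem_set// => s st /An; rewrite leqNgt.
  by rewrite (leq_ltn_trans st tn).
by rewrite sumEFin sumr_const_nat subn0.
Qed.

Lemma first_time_sum (A : set nat) :
  first_time A = (\sum_(0 <= t <oo) (\1_(not_yet A) t)%:E)%E :> \bar R.
Proof.
have [[t At]|noA] := pselect (exists t, A t).
  have exA : exists t, `[< A t >] by exists t; apply/asboolP.
  pose m := ex_minn exA.
  have [mA m_min] : A m /\ forall s, A s -> (m <= s)%N.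
    rewrite /m; case: ex_minnP => k /asboolP Ak kmin; split => // s As.
    by apply: kmin; apply/asboolP.
  have -> : first_time A = m%:R%:E :> \bar R.
    apply/eqP; rewrite eq_le; apply/andP; split.
      by apply: ereal_inf_lbound; exists m.
    by apply: le_ereal_inf_tmp => _ [s As <-]; rewrite lee_fin ler_nat m_min.
  apply/esym/lim_near_cst; first by apply: ereal_hausdorff.
  exists m => // n /= mn.
  rewrite (big_cat_nat (leq0n m) mn) /= (partial_sum_not_yet m_min) big_nat_cond big1 ?adde0//.
  move=> s /andP[/andP[ms _] _]; rewrite indicE memNset//.
  by move=> /(_ m ms); apply.
have -> : first_time A = +oo%E :> \bar R.
  rewrite /first_time (_ : A = set0) ?image_set0 ?ereal_inf0//.
  by rewrite -subset0 => t At; apply: noA; exists t.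
apply/esym/cvg_lim => //.
rewrite (_ : (fun n => _) = fun n => (n%:R : R)%:E); last first.
  by apply: funext => n; rewrite partial_sum_not_yet// => t At; case: noA; exists t.
exact/cvgenyP.
Qed.

(** Tail-sum formula, by exchanging the integral with a series of nonnegative terms. *)
Lemma integral_first_time d (T : measurableType d) (mu : {measure set T -> \bar R})
    (A : nat -> set T) : (forall t, measurable (A t)) ->
  (\int[mu]_w first_time [set t | A t w] =
   \sum_(0 <= t <oo) mu [set w | forall s, (s <= t)%N -> ~ A s w])%E.
Proof.
move=> mA.
have mB t : measurable [set w | forall s, (s <= t)%N -> ~ A s w].
  rewrite (_ : [set w | _] = \bigcap_(s in [set s | (s <= t)%N]) ~` A s).
    by apply: bigcap_measurableType => s _; apply: measurableC.
  by apply/seteqP; split.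
under eq_integral do rewrite first_time_sum.
rewrite integral_nneseries//=.
- apply: eq_eseriesr => t _; rewrite -(setIT [set w | _]) -integral_indic//.
- move=> t; apply/measurable_EFinP.
  rewrite (_ : (fun w => _) = \1_[set w | forall s, (s <= t)%N -> ~ A s w]).
    by apply/measurable_indicP; exact: mB.
  by apply: funext => w; rewrite !indicE; congr (_%:R); apply: asbool_equiv_eq.
Qed.

End FirstTime.

Lemma measure_finite_partition (R : realType) d (T : measurableType d)
    (mu : {measure set T -> \bar R}) (K : finType) (E : K -> set T) :
  (forall k, measurable (E k)) -> (forall k k' w, E k w -> E k' w -> k = k') ->
  mu [set w | exists k, E k w] = (\sum_(k : K) mu (E k))%E.
Proof.
move=> mE tE.
have -> : [set w | exists k, E k w] = \bigcup_(k in setT) E k.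
  by apply/seteqP; split => [w [k Ek]|w [k _ Ek]]; exists k.
have setTE : [set: K] = [set` enum K].
  by apply/seteqP; split => k //= _; rewrite mem_enum.
rewrite measure_fin_bigcup//; first by rewrite setTE -fsbig_seq ?enum_uniq// big_enum.
  exact: finite_finset.
by move=> k k' _ _ [w [Ek Ek']]; exact: tE Ek Ek'.
Qed.

(** * A Markov chain on the unit interval *)

Section IntervalWalk.
Context {R : realType} {V : finType}.
Variables (P : V -> V -> R) (sP : stochastic P).
Implicit Types (u v : V) (a l w : R).

Definition cumulative (p : V -> R) v := \sum_(v' | (enum_rank v' < enum_rank v)%N) p v'.

Definition in_cell u a l w v :=
  (a + l * cumulative (P u) v <= w) && (w < a + l * cumulative (P u) v + l * P u v).

(* A state [(u, a, l)] is a vertex with an interval [[a, a + l)], which is cut into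
   consecutive cells of lengths [l * P u v]; the walk at the point [w] of the interval
   moves to the vertex whose cell contains [w]. *)
Definition cell u a l w := odflt u [pick v | in_cell u a l w v].

Fixpoint walk t u a l w : V :=
  if t is t'.+1 then
    let v := cell u a l w in walk t' v (a + l * cumulative (P u) v) (l * P u v) w
  else u.

Definition trajectory t u a l w := [seq walk s u a l w | s <- iota 0 t.+1].

Lemma trajectoryS t u a l w : trajectory t.+1 u a l w =
  let v := cell u a l w in
  u :: trajectory t v (a + l * cumulative (P u) v) (l * P u v) w.
Proof.
rewrite /trajectory -[t.+2]/(1 + t.+1)%N iotaD map_cat; congr (_ :: _).
by rewrite -[(0 + 1)%N]/(1 + 0)%N iotaDl -map_comp.
Qed.

Fixpoint path_prob t u (Q : pred (seq V)) : R :=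
  if t is t'.+1 then \sum_v P u v * path_prob t' v (fun s => Q (u :: s))
  else (Q [:: u])%:R.

Let cumul u (k : nat) := \sum_(v' : V | (enum_rank v' < k)%N) P u v'.

Let cumul_rank u v : cumul u (enum_rank v).+1 = cumulative (P u) v + P u v.
Proof.
rewrite /cumul (bigD1 v)//= addrC; congr (_ + _); apply: eq_bigl => v'.
rewrite ltnS leq_eqVlt -(inj_eq enum_rank_inj) andb_orl.
by rewrite -(inj_eq val_inj) andbN /= ltn_neqAle andbC andbA andbb.
Qed.

Let cumul_mono u k k' : (k <= k')%N -> cumul u k <= cumul u k'.
Proof.
move=> kk'; rewrite /cumul [leRHS](bigID (fun v => (enum_rank v < k)%N))/=.
rewrite [X in _ <= X + _](eq_bigl (fun v => (enum_rank v < k)%N)).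
  by rewrite lerDl; apply: sumr_ge0 => v _; case: sP.
by move=> v; rewrite andb_idl// => /leq_trans; apply.
Qed.

Let cumul_card u : cumul u #|V| = 1.
Proof. by case: sP => _ /(_ u) <-; apply: eq_bigl => v; rewrite ltn_ord. Qed.

Lemma in_cell_uniq u a l w v v' : 0 <= l ->
  in_cell u a l w v -> in_cell u a l w v' -> v = v'.
Proof.
move=> l0; wlog : v v' / (enum_rank v < enum_rank v')%N.
  move=> H cv cv'; case: (ltngtP (enum_rank v) (enum_rank v')) => [/H|/H|]; [exact| |].
    by move=> /(_ cv' cv).
  by move=> /val_inj/enum_rank_inj.
move=> vv' /andP[_ wv] /andP[wv' _]; exfalso.
have := le_lt_trans wv' wv; rewrite -addrA -mulrDr -cumul_rank ltrD2l ltNge.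
by rewrite (ler_wpM2l l0 (cumul_mono u vv')).
Qed.

Lemma in_cell_interval u a l w v : 0 <= l -> in_cell u a l w v -> a <= w < a + l.
Proof.
move=> l0 /andP[aw wa]; apply/andP; split.
  apply: le_trans aw; rewrite lerDl mulr_ge0// sumr_ge0// => v' _; by case: sP.
apply: lt_le_trans wa _; rewrite -addrA -mulrDr -cumul_rank lerD2l.
by rewrite -[leRHS]mulr1 ler_wpM2l// -(cumul_card u) cumul_mono.
Qed.

Lemma in_cell_exists u a l w : a <= w < a + l -> exists v, in_cell u a l w v.
Proof.
move=> /andP[aw wa].
have exk : exists k, w < a + l * cumul u k by exists #|V|; rewrite cumul_card mulr1.
case: (ex_minnP exk) => -[|k] wk kmin.
  by move: wk; rewrite /cumul big_pred0// mulr0 addr0 ltNge aw.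
have kV : (k < #|V|)%N.
  by rewrite (leq_trans (kmin #|V| _))// cumul_card mulr1.
exists (enum_val (Ordinal kV)); rewrite /in_cell -addrA -mulrDr -cumul_rank.
rewrite /cumulative enum_valK /= wk andbT leNgt.
by apply/negP => /kmin; rewrite ltnn.
Qed.

Lemma cellE u a l w v : 0 <= l -> in_cell u a l w v -> cell u a l w = v.
Proof.
move=> l0 cv; rewrite /cell; case: pickP => [v' cv'|/(_ v)]; last by rewrite cv.
exact: in_cell_uniq l0 cv' cv.
Qed.

(** Induction on [t]: the cells partition the interval, and on the cell of [v] the remaining walk is
    of the same kind, on an interval of length [l * P u v]. *)
Lemma walk_law t u a l (Q : pred (seq V)) : 0 <= l ->
  let E := [set w | a <= w < a + l /\ Q (trajectory t u a l w)] in
  measurable E /\ lebesgue_measure E = (l * path_prob t u Q)%:E.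
Proof.
elim: t u a l Q => [|t IH] u a l Q l0 /=.
  have [Qu|Qu] := boolP (Q [:: u]).
    rewrite (_ : [set w | _] = `[a, a + l[%classic).
      split; first exact: measurable_itv.
      rewrite lebesgue_measure_itv/= lte_fin mulr1 ltrDl; case: ltP.
        by rewrite -EFinD addrC addKr.
      by move=> l0'; congr _%:E; apply: le_anti; rewrite l0 l0'.
    by apply/seteqP; split => w /=; rewrite in_itv/= => // -[].
  rewrite (_ : [set w | _] = set0); first by rewrite measure0 mulr0.
  by rewrite -subset0 => w /= [].
pose F v := [set w | a + l * cumulative (P u) v <= w < a + l * cumulative (P u) v + l * P u v
  /\ Q (u :: trajectory t v (a + l * cumulative (P u) v) (l * P u v) w)].
have lP v : 0 <= l * P u v by rewrite mulr_ge0//; case: sP.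
have FE v := IH v (a + l * cumulative (P u) v) (l * P u v) (fun s => Q (u :: s)) (lP v).
have -> : [set w | a <= w < a + l /\ Q (trajectory t.+1 u a l w)] =
    [set w | exists v, F v w].
  apply/seteqP; split => w /=.
    move=> [aw]; have [v cv] := in_cell_exists u aw.
    by rewrite trajectoryS (cellE l0 cv) => Qw; exists v.
  move=> [v [cv Qw]]; split; first exact: in_cell_interval l0 cv.
  by rewrite trajectoryS (cellE l0 cv).
split.
  rewrite (_ : [set w | _] = \bigcup_(v in setT) F v).
    by apply: fin_bigcup_measurable => // v _; case: (FE v).
  by apply/seteqP; split => [w [v Fv]|w [v _ Fv]]; exists v.
rewrite measure_finite_partition.
- rewrite mulr_sumr -sumEFin; apply: eq_bigr => v _.
  by rewrite mulrA; exact: (proj2 (FE v)).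
- by move=> v; case: (FE v).
- by move=> v v' w [cv _] [cv' _]; apply: in_cell_uniq l0 cv cv'.
Qed.

End IntervalWalk.

Section WalkProbability.
Context {R : realType} {V : finType}.
Variables (P : V -> V -> R) (sP : stochastic P).
Implicit Types (u v : V) (t : nat) (Q : pred (seq V)).

Lemma eq_path_prob t u Q Q' : Q =1 Q' -> path_prob P t u Q = path_prob P t u Q'.
Proof.
elim: t u Q Q' => [|t IH] u Q Q' QQ' /=; first by rewrite QQ'.
by apply: eq_bigr => v _; congr (_ * _); apply: IH => s; rewrite QQ'.
Qed.

Lemma path_prob_andb t u (b : bool) Q :
  path_prob P t u (fun s => b && Q s) = b%:R * path_prob P t u Q.
Proof.
case: b; first by rewrite mul1r; apply: eq_path_prob.
rewrite mul0r; elim: t u Q => [//|t IH] u Q.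
apply: big1 => v _; apply/eqP; rewrite mulf_eq0; apply/orP; right; apply/eqP.
exact: (IH v (fun s => Q (u :: s))).
Qed.

Definition follows (x : nat -> V) t : pred (seq V) :=
  fun s => s == [seq x i | i <- iota 0 t.+1].

Lemma path_prob_followsS x t u : path_prob P t.+1 u (follows x t.+1) =
  (u == x 0%N)%:R * \sum_v P u v * path_prob P t v (follows (fun i => x i.+1) t).
Proof.
rewrite /= mulr_sumr; apply: eq_bigr => v _; rewrite mulrCA -path_prob_andb.
congr (_ * _); apply: eq_path_prob => s; rewrite /follows.
rewrite -[t.+2]/(1 + t.+1)%N iotaD map_cat eqseq_cons.
by rewrite -[(0 + 1)%N]/(1 + 0)%N iotaDl -map_comp.
Qed.

(** [path_prob] recurses on the first move, whereas [markov_chain] splits off the last one. *)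
Lemma path_prob_markov x t u : path_prob P t.+1 u (follows x t.+1) =
  path_prob P t u (follows x t) * P (x t) (x t.+1).
Proof.
elim: t u x => [|t IH] u x.
  rewrite path_prob_followsS /= /follows /= !eqseq_cons !andbT.
  case: eqP => [<-|_]; last by rewrite !mul0r.
  rewrite !mul1r (bigD1 (x 1%N))//= eqseq_cons eqxx mulr1 big1 ?addr0// => v /negPf vx.
  by rewrite eqseq_cons vx mulr0.
rewrite path_prob_followsS path_prob_followsS -mulrA mulr_suml; congr (_ * _).
by apply: eq_bigr => v _; rewrite IH mulrA.
Qed.

Definition survival t w u : R := path_prob P t u (fun s => w \notin s).

Lemma survivalS t w u : survival t.+1 w u = (u != w)%:R * \sum_v P u v * survival t w v.
Proof.
rewrite /survival /= mulr_sumr; apply: eq_bigr => v _; rewrite mulrCA -path_prob_andb.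
congr (_ * _); apply: eq_path_prob => s.
by rewrite inE negb_or eq_sym.
Qed.

Lemma survival0 w u : survival 0 w u = (u != w)%:R.
Proof. by rewrite /survival /= inE eq_sym. Qed.

Lemma survival_ge0 t w u : 0 <= survival t w u.
Proof.
elim: t u => [|t IH] u; first by rewrite survival0.
rewrite survivalS mulr_ge0// sumr_ge0// => v _; rewrite mulr_ge0//.
by case: sP.
Qed.

Lemma uniform_unit_interval (E : set R) : measurable E -> E `<=` `[0, 1[ ->
  uniform_prob (@ltr01 R) E = lebesgue_measure E.
Proof.
move=> mE E01; rewrite /uniform_prob.
rewrite (eq_integral (fun=> 1%E)) ?integral_cst ?mul1e// => x.
rewrite inE => /E01 /=; rewrite in_itv /= => /andP[x0 x1].
by rewrite /uniform_pdf x0 (ltW x1) /= subr0 invr1.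
Qed.

Variable u : V.

Definition unit_walk t (om : R) : V := if 0 <= om < 1 then walk P t u 0 1 om else u.

Lemma unit_walk_law t Q :
  let E := [set om | Q [seq unit_walk s om | s <- iota 0 t.+1]] in
  measurable E /\ uniform_prob (@ltr01 R) E = (path_prob P t u Q)%:E.
Proof.
move=> E; pose pr : probability _ R := uniform_prob (@ltr01 R).
have mI : measurable (`[0, 1[%classic : set R) by exact: measurable_itv.
have prI : pr `[0, 1[%classic = 1%E.
  by rewrite /pr/= uniform_unit_interval// lebesgue_measure_itv/= lte_fin ltr01 oppr0 adde0.
have prC : pr (~` `[0, 1[%classic) = 0%E by rewrite probability_setC// prI subee.
have EI : E `&` `[0, 1[%classic =
    [set om | 0 <= om < 0 + 1 /\ Q (trajectory P t u 0 1 om)].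
  apply/seteqP; split => om /=; rewrite in_itv/= add0r /E /trajectory /unit_walk /=.
    by move=> [Qom I]; move: Qom; rewrite I.
  by move=> [I Qom]; rewrite I.
have [mEI lawEI] := walk_law sP t u 0 Q (ler01 : 0 <= 1 :> R).
rewrite -EI in mEI lawEI.
have mEC : measurable (E `&` ~` `[0, 1[%classic).
  have [b Eb] : exists b : bool, forall om, ~ (`[0, 1[%classic om) -> E om = b.
    exists (Q [seq u | s <- iota 0 t.+1]) => om; rewrite /= in_itv /= /E /unit_walk /=.
    by move=> /negP/negPf ->.
  rewrite (_ : _ `&` _ = if b then ~` `[0, 1[%classic else set0).
    by case: (b) => //; exact: measurableC.
  apply/seteqP; split => om /=.
    by move=> [Eom nI]; move: Eom; rewrite (Eb om nI); case: (b).
  by case: b Eb => // Eb nI; split => //; rewrite Eb.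
have EE : E = (E `&` `[0, 1[%classic) `|` (E `&` ~` `[0, 1[%classic).
  by rewrite -setIUr setUv setIT.
split; first by rewrite EE; apply: measurableU.
rewrite -[LHS]/(pr E) EE measureU//; last first.
  by rewrite setIACA setICr setI0.
rewrite [X in (_ + X)%E](_ : _ = 0%E) ?adde0; last first.
  apply/eqP; rewrite -measure_le0 -prC; apply: le_measure; rewrite ?inE//.
  exact: measurableC.
by rewrite /pr/= uniform_unit_interval ?lawEI ?mul1r//; apply: subIsetr.
Qed.

Lemma unit_walk_markov : markov_chain (uniform_prob (@ltr01 R)) P u unit_walk.
Proof.
have nthE t om : nth u [seq unit_walk s om | s <- iota 0 t.+1] t = unit_walk t om.
  by rewrite (nth_map 0%N) ?size_iota// nth_iota.
have followsE x t : [set om | forall s, (s <= t)%N -> unit_walk s om = x s] =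
    [set om | follows x t [seq unit_walk s om | s <- iota 0 t.+1]].
  apply/seteqP; split => om H.
    by apply/eqP/eq_in_map => s; rewrite mem_iota => /andP[_ st]; apply: H.
  by move=> s st; move/eqP/eq_in_map: H; apply; rewrite mem_iota.
split.
- move=> t v; have [mE _] := unit_walk_law t (fun s => nth u s t == v).
  rewrite (_ : _ @^-1` _ =
      [set om | nth u [seq unit_walk s om | s <- iota 0 t.+1] t == v])//.
  by apply/seteqP; split => om; rewrite /mkset nthE => /eqP.
- have [_] := unit_walk_law 0 (fun s => nth u s 0 == u).
  rewrite /= eqxx => <-; congr (uniform_prob _ _).
  by apply/seteqP; split => om /= /eqP.
- move=> t x; rewrite !followsE.
  apply: (etrans (proj2 (unit_walk_law t.+1 (follows x t.+1)))).
  rewrite path_prob_markov EFinM; congr (_ * _)%E.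
  exact/esym/(proj2 (unit_walk_law t (follows x t))).
Qed.

(** [unit_walk] is one of the chains over which the supremum is taken, and the left side is a
    partial sum of the tail-sum formula for its hitting time. *)
Lemma expected_hit_ge n w :
  ((\sum_(0 <= t < n) survival t w u)%:E <= expected_hit P u w)%E.
Proof.
apply: le_trans (ereal_sup_ubound _); last first.
  exists _, _, (uniform_prob (@ltr01 R)), unit_walk; split.
    exact: unit_walk_markov.
  reflexivity.
have [mX _ _] := unit_walk_markov.
have mA t : measurable [set om | unit_walk t om = w] := mX t w.
pose pr : probability _ R := uniform_prob (@ltr01 R).
apply: (@le_trans _ _ (\sum_(0 <= t <oo)
    pr [set om | forall s, (s <= t)%N -> unit_walk s om <> w])%E); last first.
  rewrite le_eqVlt; apply/orP; left; apply/eqP/esym.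
  exact: (integral_first_time pr mA).
rewrite -sumEFin; apply: le_trans (nneseries_lim_ge n _); last by [].
apply: lee_sum => t _.
rewrite le_eqVlt; apply/orP; left; apply/eqP.
apply: (etrans (esym (proj2 (unit_walk_law t (fun s => w \notin s))))).
congr (uniform_prob _ _).
apply/seteqP; split => om; rewrite /mkset.
  move=> /mapP nw s st ws; apply: nw; exists s => //; by rewrite mem_iota.
move=> H; apply/mapP => -[s]; rewrite mem_iota => /andP[_ st] ws.
exact: (H s st).
Qed.

End WalkProbability.

Lemma hit_within_of_t_hit (R : realType) (V : finType) (P : V -> V -> R) (N : R) :
  stochastic P -> (t_hit P <= N%:E)%E -> hit_within P N.
Proof.
move=> sP hitN w.
(* [g n u] is the expected hitting time truncated at [n]. It increases with [n] and is bounded by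
   [N], and its one-step equation passes to the limit. *)
pose g n u := \sum_(0 <= t < n) survival P t w u.
have gN n u : g n u <= N.
  rewrite -lee_fin; apply: le_trans hitN; apply: le_trans (expected_hit_ge sP u n w) _.
  by apply: le_trans (le_bigmax _ _ u); apply: le_bigmax.
have gnd u : nondecreasing_seq (g ^~ u).
  apply/nondecreasing_seqP => n; rewrite /g big_nat_recr//= lerDl.
  exact: survival_ge0.
have gcv u : g ^~ u @ \oo --> limn (g ^~ u).
  by apply: nondecreasing_is_cvgn => //; exists N => _ [n _ <-].
have gS n u : g n.+1 u = (u != w)%:R * (1 + apply_mx P (g n) u).
  rewrite /g big_nat_recl//= survival0.
  under eq_bigr do rewrite survivalS.
  rewrite -mulr_sumr mulrDr mulr1; congr (_ + _ * _).
  by rewrite exchange_big; apply: eq_bigr => v _; rewrite mulr_sumr.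
exists (fun u => limn (g ^~ u)); split.
- apply/cvg_lim => //; rewrite -cvg_shiftS.
  under eq_fun do rewrite gS eqxx mul0r.
  exact: cvg_cst.
- move=> u; apply/andP; split.
    apply: limr_ge; first exact: gcv.
    by apply: nearW => n; apply: sumr_ge0 => t _; apply: survival_ge0.
  by apply: limr_le; [exact: gcv|apply: nearW].
move=> u uw; apply: cvg_lim => //; rewrite -cvg_shiftS.
under eq_fun do rewrite gS uw mul1r.
apply: cvgD; first exact: cvg_cst.
apply: cvg_big => [|v _]; first exact: add_continuous.
exact: cvgMl_tmp (gcv v).
Qed.

(** * Pull voting and coalescence *)

Section Voting.
Context {R : realType} {V : finType} d (Omega : measurableType d).
Variables (Pr : probability Omega R) (P : nat -> V -> V -> R) (Y : nat -> V -> Omega -> V).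
Hypothesis Ypicks : pull_picks Pr P Y.

(** The latest round comes first, as ancestral lines are followed backwards in time. *)
Fixpoint rounds t : seq (V -> V -> R) := if t is t'.+1 then P t :: rounds t' else [::].

Lemma size_rounds t : size (rounds t) = t.
Proof. by elim: t => //= t ->. Qed.

(* The vertices from which the opinions held on [S] after [t] rounds come; read
   backwards in time, they form coalescing walks. *)
Fixpoint ancestors t (S : {set V}) (w : Omega) : {set V} :=
  if t is t'.+1 then ancestors t' (imset (fun u => Y t u w) (mem S)) w else S.

Lemma opinions_ancestors (Sigma : Type) (xi0 : V -> Sigma) t (S : {set V}) w u v :
  (#|ancestors t S w| <= 1)%N -> u \in S -> v \in S ->
  opinions Y xi0 t w u = opinions Y xi0 t w v.
Proof.
elim: t S u v => [|t IH] S u v /= S1 uS vS.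
  by rewrite (card_le1_eqP S1 u v).
by apply: IH S1 _ _; apply: imset_f.
Qed.

Definition picks_on a b (y : nat -> V -> V) : set Omega :=
  [set w | forall s u, (a < s <= b)%N -> Y s u w = y s u].

Lemma measurable_picks_on a b y : measurable (picks_on a b y).
Proof.
have [mY _ _] := Ypicks.
rewrite (_ : picks_on a b y = \bigcap_(s in [set s | (a < s <= b)%N])
    \bigcap_(u in setT) (Y s u @^-1` [set y s u])).
  apply: bigcap_measurableType => s /= /andP[sa _].
  apply: fin_bigcap_measurable => [|u _]; first exact: finite_finset.
  by apply: mY; apply: leq_ltn_trans sa.
by apply/seteqP; split => [w H s sab u _|w H s u sab]; apply: H.
Qed.

Definition round_picks t (z : {ffun V -> V}) : set Omega :=
  picks_on t t.+1 (fun _ u => z u).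

Lemma round_picksP t z w : round_picks t z w <-> z = [ffun u => Y t.+1 u w].
Proof.
split => [H|-> s u]; last by rewrite -eqn_leq => /eqP <-; rewrite ffunE.
by apply/ffunP => u; rewrite ffunE H// leqnn andbT.
Qed.

Lemma measurable_round_partition t (E : {ffun V -> V} -> set Omega) :
  (forall z, measurable (E z)) ->
  measurable [set w | E [ffun u => Y t.+1 u w] w].
Proof.
move=> mE.
rewrite (_ : [set w | _] = \bigcup_(z in setT) (round_picks t z `&` E z)).
  apply: fin_bigcup_measurable => [|z _]; first exact: finite_finset.
  by apply: measurableI => //; apply: measurable_picks_on.
apply/seteqP; split => w /= => [Ew|[z _ [/round_picksP -> //]]].
by exists [ffun u => Y t.+1 u w] => //; split => //; apply/round_picksP.
Qed.

Lemma measurable_opinions (Sigma : Type) (xi0 : V -> Sigma) t (Q : (V -> Sigma) -> Prop) :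
  measurable [set w | Q (opinions Y xi0 t w)].
Proof.
elim: t Q => [|t IH] Q /=.
  have [q|q] := pselect (Q xi0).
    by rewrite (_ : [set w | _] = setT)//; apply/seteqP; split.
  by rewrite (_ : [set w | _] = set0)//; apply/seteqP; split.
have := measurable_round_partition t
  (E := fun z => [set w | Q (fun u => opinions Y xi0 t w (z u))])
  (fun z => IH (fun xi => Q (fun u => xi (z u)))).
rewrite /=; congr measurable; apply/seteqP; split => w /=;
  congr Q; apply: funext => u; by rewrite ffunE.
Qed.

Lemma ancestorsS t S w :
  ancestors t.+1 S w = ancestors t ([ffun u => Y t.+1 u w] @: S)%SET w.
Proof.
rewrite /=; congr (ancestors t _ w); apply: eq_imset => u; by rewrite ffunE.
Qed.

Lemma measurable_ancestors t S : measurable [set w | (1 < #|ancestors t S w|)%N].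
Proof.
elim: t S => [|t IH] S.
  rewrite /=; case: (1 < #|S|)%N.
    by rewrite (_ : [set w | _] = setT)//; apply/seteqP; split.
  by rewrite (_ : [set w | _] = set0)//; apply/seteqP; split.
under eq_set do rewrite ancestorsS.
exact: (measurable_round_partition t
  (E := fun z => [set w | (1 < #|ancestors t (z @: S)%SET w|)%N])).
Qed.

Lemma picks_on_law b y : Pr (picks_on 0 b y) =
  (\prod_(0 <= s < b) \prod_u P s.+1 u (y s.+1 u))%:E.
Proof.
have [_ lawY indY] := Ypicks.
pose l := [seq (s.+1, u) | s <- iota 0 b, u <- enum V].
have ul : uniq l.
  apply: allpairs_uniq; rewrite ?iota_uniq ?enum_uniq//.
  by move=> [s u] [s' u'] _ _ /= [-> ->].
have lP s u : ((s, u) \in l) = (0 < s <= b)%N.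
  apply/allpairsP/idP => [[[s' u'] /= [+ _ [-> _]]]|]; first by rewrite mem_iota.
  case: s => // s sb; exists (s, u) => /=; split => //; last by rewrite mem_enum.
  by rewrite mem_iota.
have -> : picks_on 0 b y = [set w | forall i, i \in l -> Y i.1 i.2 w = y i.1 i.2].
  apply/seteqP; split => [w H [s u]|w H s u sb]; first by rewrite lP; apply: H.
  by apply: (H (s, u)); rewrite lP.
rewrite indY//; last by move=> [s u]; rewrite lP => /andP[].
rewrite /l big_allpairs_dep -prodEFin /index_iota subn0; apply: eq_bigr => s _.
rewrite -prodEFin big_enum /=; apply: eq_bigr => u _.
exact: lawY.
Qed.

(** Independence is available for events that prescribe picks, so the picks of the rounds [t + 1] to
    [t + k] are carried along. The induction splits according to the picks of one more round, which
    then join the prescribed ones. The law of [ancestors] is the case [k = 0]. *)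
Lemma ancestors_law t k y S :
  Pr (picks_on t (t + k) y `&` [set w | (1 < #|ancestors t S w|)%N]) =
  ((\prod_(t <= s < t + k) \prod_u P s.+1 u (y s.+1 u)) * coal (rounds t) S)%:E.
Proof.
elim: t k y S => [|t IH] k y S.
  rewrite add0n /=; case: (1 < #|S|)%N.
    rewrite (_ : [set w | _] = setT) ?setIT ?mulr1 ?picks_on_law//.
    by apply/seteqP; split.
  rewrite (_ : [set w | _] = set0) ?setI0 ?mulr0 ?measure0//.
  by apply/seteqP; split.
pose y' (z : {ffun V -> V}) s := if s == t.+1 then fun u => z u else y s.
pose E z := picks_on t (t + k.+1) (y' z) `&` [set w | (1 < #|ancestors t (z @: S)%SET w|)%N].
have Ez z w : E z w -> z = [ffun u => Y t.+1 u w].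
  move=> [H _]; apply/ffunP => u; rewrite ffunE H /y' ?eqxx//.
  by rewrite ltnSn addnS ltnS leq_addr.
have -> : picks_on t.+1 (t.+1 + k) y `&` [set w | (1 < #|ancestors t.+1 S w|)%N] =
    [set w | exists z, E z w].
  apply/seteqP; split => w.
    move=> [H]; rewrite /mkset ancestorsS => anc.
    exists [ffun u => Y t.+1 u w]; split => // s u; rewrite addnS -addSn => /andP[ts sk].
    rewrite /y'; case: eqP => [->|/eqP st]; first by rewrite ffunE.
    by apply: H; rewrite sk andbT ltn_neqAle eq_sym st.
  move=> [z Ezw]; have zE := Ez z w Ezw; case: Ezw => H anc; split.
    move=> s u /andP[ts sk]; rewrite H /y'; last by rewrite addnS -addSn sk andbT ltnW.
    by rewrite gtn_eqF.
  by rewrite /mkset ancestorsS -zE.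
rewrite measure_finite_partition; last 2 first.
- move=> z; apply: measurableI; first exact: measurable_picks_on.
  exact: measurable_ancestors.
- by move=> z z' w /Ez -> /Ez ->.
rewrite (eq_bigr _ (fun z _ => IH k.+1 (y' z) (z @: S)%SET)).
rewrite sumEFin; congr _%:E; rewrite /= mulr_sumr; apply: eq_bigr => z _.
rewrite big_ltn ?addnS ?ltnS ?leq_addr// addSn.
rewrite (_ : \prod_u P t.+1 u (y' z t.+1 u) = move_prob (P t.+1) [ffun u => u] z).
  rewrite (_ : \prod_(t.+1 <= s < _) _ =
    \prod_(t.+1 <= s < (t + k).+1) \prod_u P s.+1 u (y s.+1 u)); first by ring.
  apply: eq_big_nat => s /andP[ts _]; apply: eq_bigr => u _.
  by rewrite /y' eqSS gtn_eqF.
by apply: eq_bigr => u _; rewrite /y' eqxx ffunE.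
Qed.

Lemma tau_cons_le (Sigma : Type) (xi0 : V -> Sigma) (c : nat -> R) :
  (forall t, coal (rounds t) [set: V]%SET <= c t) ->
  (\int[Pr]_w tau_cons Y xi0 w <= \sum_(0 <= t <oo) (c t)%:E)%E.
Proof.
move=> coal_c.
have mA t : measurable [set w | consensus (opinions Y xi0 t w)].
  exact: measurable_opinions.
rewrite (_ : (\int[Pr]_w _)%E = (\sum_(0 <= t <oo)
    Pr [set w | forall s, (s <= t)%N -> ~ consensus (opinions Y xi0 s w)])%E); last first.
  exact: (integral_first_time Pr mA).
apply: lee_nneseries => [t _ _|t _]; first exact: measure_ge0.
apply: (@le_trans _ _ (Pr [set w | (1 < #|ancestors t [set: V]%SET w|)%N])).
  apply: le_measure; rewrite ?inE.
  - rewrite (_ : [set w | _] = \bigcap_(s in [set s | (s <= t)%N])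
        ~` [set w | consensus (opinions Y xi0 s w)]).
      by apply: bigcap_measurableType => s _; apply: measurableC.
    by apply/seteqP; split.
  - exact: measurable_ancestors.
  move=> w /= /(_ t (leqnn t)) ncons; rewrite ltnNge; apply/negP => anc1.
  by apply: ncons => u v; apply: opinions_ancestors anc1 _ _; rewrite inE.
have := ancestors_law t 0 (fun _ u => u) [set: V]%SET.
rewrite addn0 big_geq// mul1r (_ : picks_on t t _ = setT).
  by rewrite setTI => ->; rewrite lee_fin.
by apply/seteqP; split => // w _ s u /andP[ts st]; move: (leq_trans ts st); rewrite ltnn.
Qed.

End Voting.

(** * Geometric tail and conclusion *)

Lemma geometric_blocks (R : realType) (T m : nat) :
  \sum_(0 <= t < m * T) (2^-1 : R) ^+ (t %/ T) = T%:R * (2 - 2 * 2^-1 ^+ m).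
Proof.
elim: m => [|m IH]; first by rewrite mul0n big_geq// expr0 mulr1 subrr mulr0.
rewrite (@big_cat_nat _ _ _ (m * T)) ?leq_mul2r ?leqnSn ?orbT//= IH.
rewrite (eq_big_nat _ _ (F2 := fun=> 2^-1 ^+ m)); last first.
  move=> t /andP[mt tm]; congr (_ ^+ _); apply/eqP.
  have T0 : (0 < T)%N by case: T mt tm {IH} => // mt; rewrite muln0 ltn0.
  by rewrite eqn_leq -ltnS ltn_divLR// tm leq_divRL.
rewrite sumr_const_nat mulSn addnK exprS -[X in _ + X]mulr_natl.
by field.
Qed.

Lemma sum_geometric_blocks (R : realType) (T : nat) : (0 < T)%N ->
  (\sum_(0 <= t <oo) ((2^-1 : R) ^+ (t %/ T))%:E <= (2 * T%:R)%:E)%E.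
Proof.
move=> T0; have p0 t : 0 <= (2^-1 : R) ^+ (t %/ T) by apply: exprn_ge0.
apply: lime_le.
  by apply: is_cvg_nneseries => t _ _; rewrite lee_fin.
apply: nearW => n; rewrite sumEFin lee_fin.
apply: (@le_trans _ _ (\sum_(0 <= t < n * T) (2^-1 : R) ^+ (t %/ T))).
  rewrite [leRHS](@big_cat_nat _ _ _ n) ?leq_pmulr//= lerDl.
  exact: sumr_ge0.
rewrite geometric_blocks mulrC ler_wpM2r// gerBl mulr_ge0// exprn_ge0//.
Qed.

Lemma coal_blocks (R : realFieldType) (V : finType) (pi : V -> R) (n k : nat)
    (L : seq (V -> V -> R)) :
  (forall v, 0 <= pi v) -> \sum_v pi v = 1 -> (0 < n)%N -> (forall v, 0 < pi v) ->
  good_seq pi L n%:R -> (k * coalescence_length V n <= size L)%N ->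
  coal L [set: V]%SET <= 2^-1 ^+ k.
Proof.
move=> pi_ge0 pi_sum1 n_gt0 pi_gt0.
elim: k L => [|k IH] L gL.
  by rewrite expr0; have /andP[] := coal_bounds [set: V]%SET (good_stochastic_seq gL).
rewrite mulSn => sL; rewrite -(cat_take_drop (coalescence_length V n) L) in gL *.
have sL1 : size (take (coalescence_length V n) L) = coalescence_length V n.
  by rewrite size_takel// (leq_trans _ sL)// leq_addr.
have sL2 : (k * coalescence_length V n <= size (drop (coalescence_length V n) L))%N.
  by rewrite size_drop leq_subRL ?(leq_trans _ sL)// leq_addr.
move: (take _ L) (drop _ L) gL sL1 sL2 => L1 L2 /good_seq_cat[gL1 gL2] sL1 sL2.
apply: le_trans (coal_cat _ (good_stochastic_seq gL1) (good_stochastic_seq gL2)) _.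
rewrite exprS; apply: ler_pM.
- by have /andP[] := coal_bounds [set: V]%SET (good_stochastic_seq gL1).
- by have /andP[] := coal_bounds [set: V]%SET (good_stochastic_seq gL2).
- exact: (coal_half pi_ge0 pi_sum1 n_gt0 pi_gt0 gL1 sL1).
- exact: IH.
Qed.

Theorem theorem1p8 (R : realType) :
  exists C : R, 0 < C /\
    forall (V : finType) (P : nat -> V -> V -> R) (pi : V -> R),
      (2 <= #|V|)%N ->
      (forall t, (1 <= t)%N ->
        [/\ transition_matrix (P t), irreducible (P t), lazy (P t),
            stationary (P t) pi & reversible (P t) pi]) ->
      forall (d : measure_display) (Omega : measurableType d)
        (Pr : probability Omega R) (Y : nat -> V -> Omega -> V)
        (xi0 : V -> 'I_#|V|),
        pull_picks Pr P Y ->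
        (\int[Pr]_w tau_cons Y xi0 w <= C%:E * t_HIT P)%E.
Proof.
(* [248 = 2 * 62 * 2]: the geometric tail costs a factor [2], a block has at most [62 n] rounds, and
   [n <= H + 1 <= 2 H]. *)
exists 248; split => // V P pi V2 hP d Omega Pr Y xi0 picks.
have sP t : (1 <= t)%N -> stochastic (P t).
  by move=> /hP[[P01 P1] _ _ _ _]; split => // u v; have /andP[] := P01 u v.
have hit_le t : (1 <= t)%N -> (t_hit (P t) <= t_HIT P)%E.
  by move=> t1; apply: ereal_sup_ubound; exists t.
(* Hitting a different vertex takes at least one round. This absorbs the rounding of [t_HIT] to an
   integer into the constant, and excludes the value [-oo]. *)
have HIT_ge1 : (1 <= t_HIT P)%E.
  apply: le_trans (hit_le 1%N isT).
  have [u [w uw]] : exists u w : V, u != w.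
    by have /card_gt1P[u [w [_ _ uw]]] := V2; exists u, w.
  apply: (@le_trans _ _ (expected_hit (P 1%N) u w)); last first.
    by apply: le_trans (le_bigmax _ _ u); apply: le_bigmax.
  have := expected_hit_ge (sP 1%N isT) u 1 w.
  by rewrite big_nat1 survival0 uw.
case HE : (t_HIT P) => [H| |]; last 2 first.
- by rewrite gt0_muley ?lte_fin// leey.
- by move: HIT_ge1; rewrite HE.
have H1 : 1 <= H by rewrite -lee_fin -HE.
pose n := (Num.truncn H).+1.
have [nH Hn] : H <= n%:R /\ n%:R <= H + 1.
  have /andP[lo hi] := truncn_itv (le_trans ler01 H1).
  by rewrite /n; split; [exact: ltW|rewrite -natr1 lerD2r].
have [_ _ _ [pi_ge0 pi_sum1 _] _] := hP 1%N isT.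
have gP t : (1 <= t)%N -> good pi (P t) n%:R.
  move=> t1; have [_ _ Plazy _ Prev] := hP t t1.
  have [P0 P1] := sP t t1; split => //.
  apply: hit_within_of_t_hit => //; apply: le_trans (hit_le t t1) _.
  by rewrite HE lee_fin.
have gL t : good_seq pi (rounds P t) n%:R.
  by elim: t => //= t IH; split => //; apply: gP.
have pi_gt0 := stationary_gt0 pi_ge0 pi_sum1 (gP 1%N isT).
have Vn : (#|V| <= n.+1)%N.
  have := card_le_hit pi_ge0 pi_sum1 (gP 1%N isT).
  by rewrite addrC natr1 ler_nat.
apply: le_trans (tau_cons_le picks xi0
  (c := fun t => 2^-1 ^+ (t %/ coalescence_length V n)) _) _.
  move=> t; apply: (coal_blocks pi_ge0 pi_sum1 _ pi_gt0 (gL t)) => //.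
  by rewrite size_rounds leq_divM.
apply: le_trans (sum_geometric_blocks _ _) _.
  by rewrite /coalescence_length addn_gt0 muln_gt0.
rewrite -EFinM lee_fin.
apply: (@le_trans _ _ (2 * (62 * n)%:R)).
  by apply: ler_wpM2l => //; rewrite ler_nat; apply: coalescence_length_le.
rewrite natrM; lra.
Qed.
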